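(* Let $(X,[\cdot,\cdot],\|\cdot\|)$ be a real Banach–Lie algebra with $\|[g,g']\|\le\|g\|\,\|g'\|$ for all $g,g'\in X$. Let $$\Gamma:=\Big\{(a,b)\in X\times X:\ \|a\|<2\pi,\ \ \|b\|<\int_{\|a\|}^{2\pi}\frac{du}{G(u)}\Big\},\qquad G(u)=2+\frac u2\Big(1-\cot\frac u2\Big)\ (u\in(-2\pi,2\pi)).$$ Then for every $(a,b)\in\Gamma$ the homogeneous CBHD series $\sum_{n=0}^\infty\big(\sum_{i+j=n}Z_{i,j}(a,b)\big)$ converges in $X$. The same holds for every $(a,b)$ with $\|b\|<2\pi$ and $\|a\|<\int_{\|b\|}^{2\pi}\frac{du}{G(u)}$.
   Context: Let $\mathscr T_{\mathbb R}(x,y)$ be the unital associative algebra of real polynomials in two non-commuting indeterminates $x,y$. For $i,j\in\mathbb N$ with $i+j\ge1$, $$Z_{i,j}(x,y):=\sum_{n=1}^{i+j}\frac{(-1)^{n+1}}{n}\sum_{\substack{(i_1,j_1),\dots,(i_n,j_n)\ne(0,0)\\ i_1+\dots+i_n=i,\ j_1+\dots+j_n=j}}\frac{x^{i_1}y^{j_1}\cdots x^{i_n}y^{j_n}}{i_1!j_1!\cdots i_n!j_n!},$$ and $Z_{0,0}:=0$. Each $Z_{i,j}$ belongs to the Lie subalgebra $\mathcal L(x,y)$ of $\mathscr T_{\mathbb R}(x,y)$ (with commutator bracket) generated by $x,y$. For $a,b\in X$, $u_{a,b}:\mathcal L(x,y)\to X$ is the unique Lie algebra morphism with $u_{a,b}(x)=a$,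 $u_{a,b}(y)=b$, and $Z_{i,j}(a,b):=u_{a,b}(Z_{i,j}(x,y))$. Also $\sum_{n\ge0}|K_n|u^n=G(u)$ where $\sum_nK_nz^n=\frac z{e^z-1}$. *)

(* Defs.v *)
From Stdlib Require Import Reals List Arith Bool.
Import ListNotations.
Open Scope R_scope.

Record BanachLie := {
  bl_car :> Type;
  add : bl_car -> bl_car -> bl_car;
  zero : bl_car;
  opp : bl_car -> bl_car;
  scal : R -> bl_car -> bl_car;
  norm : bl_car -> R;
  br : bl_car -> bl_car -> bl_car;
  add_assoc : forall x y z, add x (add y z) = add (add x y) z;
  add_comm : forall x y, add x y = add y x;
  add_zero : forall x, add x zero = x;
  add_opp : forall x, add x (opp x) = zero;
  scal_one : forall x, scal 1 x = x;
  scal_assoc : forall r s x, scal r (scal s x) = scal (r * s) x;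
  scal_distr_l : forall r x y, scal r (add x y) = add (scal r x) (scal r y);
  scal_distr_r : forall r s x, scal (r + s) x = add (scal r x) (scal s x);
  norm_nonneg : forall x, 0 <= norm x;
  norm_eq0 : forall x, norm x = 0 -> x = zero;
  norm_triangle : forall x y, norm (add x y) <= norm x + norm y;
  norm_scal : forall r x, norm (scal r x) = Rabs r * norm x;
  complete : forall u : nat -> bl_car,
    (forall eps, eps > 0 -> exists N, forall m n, (m >= N)%nat -> (n >= N)%nat ->
       norm (add (u m) (opp (u n))) < eps) ->
    exists l, forall eps, eps > 0 -> exists N, forall n, (n >= N)%nat ->
       norm (add (u n) (opp l)) < eps;
  br_add_l : forall x y z, br (add x y) z = add (br x z) (br y z);
  br_scal_l : forall r x y, br (scal r x) y = scal r (br x y);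
  br_add_r : forall x y z, br x (add y z) = add (br x y) (br x z);
  br_scal_r : forall r x y, br x (scal r y) = scal r (br x y);
  br_alt : forall x, br x x = zero;
  br_jacobi : forall x y z,
    add (br x (br y z)) (add (br y (br z x)) (br z (br x y))) = zero
}.
Arguments add {_}. Arguments zero {_}. Arguments opp {_}. Arguments scal {_}.
Arguments norm {_}. Arguments br {_}.

(** * Noncommutative polynomials in x (= false) and y (= true), as formal
    finite sums of (coefficient, word); compared via coefficients. *)
Definition NCPoly := list (R * list bool).

Definition coef (p : NCPoly) (w : list bool) : R :=
  fold_right (fun t acc =>
    (if list_eq_dec bool_dec (snd t) w then fst t else 0) + acc) 0 p.

Definition pscal (r : R) (p : NCPoly) : NCPoly :=
  map (fun t => (r * fst t, snd t)) p.

Definition pmul (p q : NCPoly) : NCPoly :=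
  flat_map (fun s => map (fun t => (fst s * fst t, snd s ++ snd t)) q) p.

Fixpoint comps (n i j : nat) : list (list (nat * nat)) :=
  match n with
  | O => if (Nat.eqb i 0 && Nat.eqb j 0)%bool then [nil] else nil
  | S n' =>
      flat_map (fun i1 =>
        flat_map (fun j1 =>
          if (Nat.eqb i1 0 && Nat.eqb j1 0)%bool then nil
          else map (cons (i1, j1)) (comps n' (i - i1) (j - j1)))
        (seq 0 (S j)))
      (seq 0 (S i))
  end.

Definition word (t : list (nat * nat)) : list bool :=
  flat_map (fun p => repeat false (fst p) ++ repeat true (snd p)) t.

Definition den (t : list (nat * nat)) : R :=
  fold_right (fun p acc => INR (fact (fst p)) * INR (fact (snd p)) * acc) 1 t.

(** Z_{i,j}(x,y); for i = j = 0 this is the empty sum, i.e. 0. *)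
Definition Zpoly (i j : nat) : NCPoly :=
  flat_map (fun n =>
    map (fun t => ((-1) ^ (n + 1) / INR n / den t, word t)) (comps n i j))
  (seq 1 (i + j)).

(** * Elements of the Lie subalgebra L(x,y) generated by x, y, presented by
    Lie expressions; every element of L(x,y) is the image of one. *)
Inductive LieExpr :=
| LX | LY | LZero
| LAdd (e1 e2 : LieExpr)
| LScal (r : R) (e : LieExpr)
| LBr (e1 e2 : LieExpr).

Fixpoint toPoly (e : LieExpr) : NCPoly :=
  match e with
  | LX => [(1, [false])]
  | LY => [(1, [true])]
  | LZero => nil
  | LAdd e1 e2 => toPoly e1 ++ toPoly e2
  | LScal r e => pscal r (toPoly e)
  | LBr e1 e2 => pmul (toPoly e1) (toPoly e2) ++
                 pscal (-1) (pmul (toPoly e2) (toPoly e1))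
  end.

Fixpoint evalL {X : BanachLie} (a b : X) (e : LieExpr) : X :=
  match e with
  | LX => a
  | LY => b
  | LZero => zero
  | LAdd e1 e2 => add (evalL a b e1) (evalL a b e2)
  | LScal r e => scal r (evalL a b e)
  | LBr e1 e2 => br (evalL a b e1) (evalL a b e2)
  end.

Definition IsZval {X : BanachLie} (i j : nat) (a b : X) (v : X) : Prop :=
  exists e : LieExpr,
    (forall w, coef (toPoly e) w = coef (Zpoly i j) w) /\ v = evalL a b e.

Fixpoint sumX {X : BanachLie} (f : nat -> X) (N : nat) : X :=
  match N with
  | O => f O
  | S N' => add (sumX f N') (f N)
  end.

Definition homog {X : BanachLie} (z : nat -> nat -> X) (n : nat) : X :=
  sumX (fun i => z i (n - i)%nat) n.

Definition series_converges {X : BanachLie} (f : nat -> X) : Prop :=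
  exists l : X, forall eps, eps > 0 -> exists N, forall M, (M >= N)%nat ->
    norm (add (sumX f M) (opp l)) < eps.

(** G(u) = 2 + u/2 (1 - cot(u/2)), extended by continuity (G(0) = 1). *)
Definition cot (x : R) : R := cos x / sin x.
Definition G (u : R) : R :=
  if Req_EM_T u 0 then 1 else 2 + u / 2 * (1 - cot (u / 2)).
Definition Ginv (u : R) : R := / G u.

(* Main.v *)
From Stdlib Require Import Reals Lra.
From Coquelicot Require Import Coquelicot.
From HB Require Import structures.
From mathcomp Require Import all_boot all_order all_algebra.
From mathcomp Require Import zify boolp Rstruct.
From mathcomp Require ring.
Require Import Defs.
Set Implicit Arguments.
Unset Strict Implicit.
Unset Printing Implicit Defensive.
Import Order.TTheory GRing.Theory Num.Theory.
Open Scope R_scope.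

(** Write [z = log (e^x e^y)] in noncommuting letters and let [D] be the derivation
    multiplying a word by its number of letters [y].  From [D (e^z) = e^z y] one gets
    [D z = sum_k c_k (ad z)^k y] with [c_k = (-1)^k K_k]; in bidegree [(i, j)] this is a
    recursion expressing [j Z_(i,j)] through brackets of lower [Z]'s.  It is checked one word
    [w] at a time, in strictly triangular matrices of size [|w| + 1] whose corner entry is the
    coefficient of [w].

    Such an identity between Lie polynomials passes to any Lie algebra [X] by the
    Dynkin-Specht-Wever formula: a Lie polynomial is recovered from its coefficients as the
    combination of the right-nested brackets of its words [w], weighted by [1 / |w|].

    Hence [S t = sum_(i, j < N) |Z_(i,j)(a, b)| t^j] satisfies [S' <= |b| G(S)], [S 0 = |a|],
    because the Riccati equation of [1 - u cot u] shows that [G] dominates the partial sums of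
    [sum_k |K_k| u^k].  Integrating [S' / G(S) <= |b|] gives [S 1 <= 2 pi] for every [N], so the
    CBHD series converges absolutely.  The second half is the same argument with the
    derivation counting [x]. *)

(** * Exponential and logarithm of nilpotent elements *)

Section TriangularSums.
Local Open Scope ring_scope.
Variable V : nmodType.

Lemma antidiagonal_sum (N : nat) (f : nat -> nat -> V) :
  \sum_(i < N) \sum_(j < N - i) f i j = \sum_(k < N) \sum_(i < k.+1) f i (k - i)%N.
Proof.
elim: N => [|N IH]; first by rewrite !big_ord0.
rewrite [RHS]big_ord_recr -IH /= big_ord_recr /= subSnn big_ord1.
rewrite [X in _ = _ + X]big_ord_recr /= subnn addrA; congr (_ + _).
rewrite -big_split; apply: eq_bigr => i _ /=.
by rewrite subSn 1?ltnW// big_ord_recr.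
Qed.

(** Turns the product of two truncated series into a Cauchy product: for nilpotent arguments the
    terms of total degree at least [N] vanish. *)
Lemma triangular_sum (N : nat) (f : nat -> nat -> V) :
  (forall i j, (N <= i + j)%N -> f i j = 0) ->
  \sum_(i < N) \sum_(j < N) f i j = \sum_(k < N) \sum_(i < k.+1) f i (k - i)%N.
Proof.
move=> f0; rewrite -antidiagonal_sum; apply: eq_bigr => i _.
rewrite [RHS](big_ord_widen N (fun j => f i j)) ?leq_subr//.
rewrite [RHS]big_mkcond; apply: eq_bigr => j _.
by case: ltnP => // h; apply: f0; rewrite -leq_subLR.
Qed.
End TriangularSums.

Section ExpLog.
Import mathcomp.algebra_tactics.ring.
Local Open Scope ring_scope.
Variable F : numFieldType.

Lemma factr_neq0 m : (m`!)%:R != 0 :> F.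
Proof. by rewrite pnatr_eq0 -lt0n fact_gt0. Qed.

(** Truncation of [log (1 + X)]; [explogp] is the truncated exponential of it. Working with
    polynomials modulo [X^(n+1)] lets the result be evaluated at any nilpotent element. *)
Definition logp n : {poly F} :=
  \sum_(i < n) ((-1) ^+ i / i.+1%:R) *: 'X^(i.+1).

Definition explogp n : {poly F} :=
  \sum_(m < n.+1) (m`!%:R)^-1 *: logp n ^+ m.

Lemma deriv_logp n : (1 + 'X) * (logp n)^`() = 1 - (- 'X) ^+ n.
Proof.
have -> : (logp n)^`() = \sum_(i < n) (- 'X) ^+ i.
  rewrite /logp raddf_sum /=; apply: eq_bigr => i _.
  rewrite derivZ derivXn /= -scaler_nat scalerA divfK ?pnatr_eq0//.
  by rewrite -[X in X *: _]signr_odd scaler_sign exprNn -signr_odd mulr_sign.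
by rewrite -[RHS]opprB subrX1 -mulNr opprB opprK.
Qed.

(** Differentiating the truncated exponential drops its last term, hence the correction. *)
Lemma deriv_explogp n :
  (explogp n)^`() = (explogp n - (n`!%:R)^-1 *: logp n ^+ n) * (logp n)^`().
Proof.
rewrite /explogp raddf_sum /= [in RHS]big_ord_recr /= addrK big_ord_recl /=.
rewrite expr0 derivZ derivE scaler0 add0r mulr_suml; apply: eq_bigr => i _.
rewrite derivZ /bump leq0n add1n derivCE /= -scaler_nat scalerA -scalerAl.
congr (_ *: _).
  by rewrite factS natrM invfM mulrAC mulVf ?mul1r// pnatr_eq0.
by rewrite mulrC.
Qed.

Lemma logp_dvdX n : exists q, logp n = q * 'X.
Proof.
exists (\sum_(i < n) ((-1) ^+ i / i.+1%:R) *: 'X^i).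
by rewrite mulr_suml; apply: eq_bigr => i _; rewrite -scalerAl exprSr.
Qed.

(** Modulo [X^n], [e = explogp n] satisfies [(1 + X) e' = e]. With constant coefficient 1 this
    determines the coefficients up to [n], and [1 + X] solves the same equation. *)
Lemma coef_explogp n k : (k <= n)%N -> (explogp n)`_k = (1 + 'X)`_k.
Proof.
have [q Eq] := logp_dvdX n.
have [t Et] : exists t, (1 + 'X) * (explogp n)^`() = explogp n + t * 'X^n.
  rewrite deriv_explogp mulrCA deriv_logp Eq exprMn exprNn scalerAl.
  set e := explogp n; set r := _ *: _; set u := 'X^n; set v := (-1) ^+ n.
  by exists (- r - e * v + r * v * u); ring.
elim: k => [|k IH] lekn.
  rewrite /explogp coef_sum big_ord_recl expr0 !coefE/= fact0 invr1 mul1r.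
  rewrite big1 ?addr0// => i _; rewrite /= /bump leq0n add1n coefZ Eq exprMn coefMXn ltn0Sn.
  by rewrite mulr0.
move: (explogp n) Et IH => e /polyP/(_ k) + IH.
rewrite mulrDl mul1r !coefD coefXM coefMXn lekn addr0 coef_deriv (IH (ltnW lekn)).
case: k lekn IH => [|k] lekn IH; rewrite !coefE /=.
  by rewrite !addr0 add0r mulr1n => ->.
rewrite (IH (ltnW lekn)) !coefE /= !add0r => /eqP.
have -> : (k.+1 == 1)%:R *+ k.+1 = (k.+1 == 1)%:R :> F.
  by case: k {lekn IH} => [|k]; rewrite ?mulr1n ?mul0rn.
by rewrite -[X in _ == X]add0r (inj_eq (addIr _)) mulrn_eq0 => /eqP.
Qed.

(** By [coef_explogp], [explogp n] differs from [1 + X] by a multiple of [X^(n+1)], which evaluation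
    at [u] kills. *)
Lemma explog_nilpotent n (A : algType F) (u : A) : u ^+ n.+1 = 0 ->
  \sum_(m < n.+1) (m`!%:R)^-1 *: (\sum_(i < n) ((-1) ^+ i / i.+1%:R) *: u ^+ i.+1) ^+ m
  = 1 + u.
Proof.
move=> u0.
have hl : horner_alg u (logp n) = \sum_(i < n) ((-1) ^+ i / i.+1%:R) *: u ^+ i.+1.
  rewrite /logp rmorph_sum /=; apply: eq_bigr => i _.
  by rewrite linearZ /= rmorphXn /= horner_algX mulr_algl.
have -> : 1 + u = horner_alg u (explogp n).
  rewrite -[explogp n](subrK (1 + 'X)) -(poly_take_drop n.+1 (explogp n - _)).
  have -> : take_poly n.+1 (explogp n - (1 + 'X)) = 0.
    apply/polyP => k; rewrite coef_take_poly coef0; case: ltnP => // lek.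
    by rewrite coefB coef_explogp// subrr.
  by rewrite add0r rmorphD rmorphM rmorphXn rmorphD rmorph1 /= !horner_algX u0 mulr0 add0r.
rewrite /explogp rmorph_sum /=; apply: eq_bigr => i _.
by rewrite linearZ /= rmorphXn /= hl mulr_algl.
Qed.
End ExpLog.

(** * The derivative of a logarithm *)

Section LogDerivative.
Import mathcomp.algebra_tactics.ring.
Local Open Scope ring_scope.
Variables (F : numFieldType) (n : nat).
Local Notation A := 'M[F]_n.+1.
Implicit Types (M N T Z U v y : A).

(** Nonzero entries lie on or beyond the [d]-th superdiagonal. This multiplicative filtration plays
    the role of the degree of a series, and [d > n] forces zero. *)
Definition upper d M := forall k l : 'I_n.+1, (l < k + d)%N -> M k l = 0.

Lemma upperW d e M : (d <= e)%N -> upper e M -> upper d M.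
Proof. by move=> de H k l lt; apply: H; apply: leq_trans lt _; rewrite leq_add2l. Qed.

Lemma upper_eq0 d M : (n < d)%N -> upper d M -> M = 0.
Proof.
move=> nd H; apply/matrixP => k l; rewrite H ?mxE//.
by rewrite (leq_trans (ltn_ord l))// (leq_trans nd)// leq_addl.
Qed.

Lemma upper0 d : upper d 0.
Proof. by move=> k l _; rewrite mxE. Qed.

Lemma upper1 : upper 0 1.
Proof.
by move=> k l; rewrite addn0 mxE => lt; case: eqP lt => // ->; rewrite ltnn.
Qed.

Lemma upperD d M N : upper d M -> upper d N -> upper d (M + N).
Proof. by move=> HM HN k l lt; rewrite mxE HM// HN// addr0. Qed.

Lemma upperN d M : upper d M -> upper d (- M).
Proof. by move=> HM k l lt; rewrite mxE HM// oppr0. Qed.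

Lemma upperB d M N : upper d M -> upper d N -> upper d (M - N).
Proof. by move=> HM HN; apply: upperD => //; apply: upperN. Qed.

Lemma upperZ d a M : upper d M -> upper d (a *: M).
Proof. by move=> HM k l lt; rewrite mxE HM// mulr0. Qed.

Lemma upper_sum d (I : Type) (r : seq I) (f : I -> A) :
  (forall i, upper d (f i)) -> upper d (\sum_(i <- r) f i).
Proof.
by move=> H; elim/big_ind: _ => //; [exact: upper0|move=> *; exact: upperD].
Qed.

Lemma upperM d e M N : upper d M -> upper e N -> upper (d + e) (M * N).
Proof.
move=> HM HN k l lt; rewrite mxE big1// => m _.
case: (ltnP m (k + d)) => h; first by rewrite HM// mul0r.
by rewrite HN ?mulr0//; lia.
Qed.

Lemma upperX M m : upper 1 M -> upper m (M ^+ m).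
Proof.
move=> H; elim: m => [|m IH]; first exact: upper1.
by rewrite exprS -add1n; apply: upperM.
Qed.

Definition ad Z v := Z * v - v * Z.

Lemma upper_ad d Z v : upper 1 Z -> upper d v -> upper d.+1 (ad Z v).
Proof.
move=> HZ Hv; apply: upperB; first by rewrite -add1n; apply: upperM.
by rewrite -addn1; apply: upperM.
Qed.

Lemma upper_iter_ad d Z v m : upper 1 Z -> upper d v -> upper (m + d) (iter m (ad Z) v).
Proof. by move=> HZ Hv; elim: m => //= m IH; rewrite addSn; apply: upper_ad. Qed.

Lemma adD Z : {morph ad Z : u v / u + v}.
Proof. by move=> u v; rewrite /ad mulrDr mulrDl opprD addrACA. Qed.

Lemma ad0 Z : ad Z 0 = 0.
Proof. by rewrite /ad mulr0 mul0r subrr. Qed.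

Lemma adZ Z a v : ad Z (a *: v) = a *: ad Z v.
Proof. by rewrite /ad -scalerAr -scalerAl scalerBr. Qed.

Lemma iter_adD Z m : {morph iter m (ad Z) : u v / u + v}.
Proof. by elim: m => // m IH u v /=; rewrite IH adD. Qed.

Lemma iter_ad0 Z m : iter m (ad Z) 0 = 0.
Proof. by elim: m => //= m ->; rewrite ad0. Qed.

Lemma iter_adZ Z m a v : iter m (ad Z) (a *: v) = a *: iter m (ad Z) v.
Proof. by elim: m => //= m ->; rewrite adZ. Qed.

Lemma iter_ad_sum Z m (I : Type) (r : seq I) (f : I -> A) :
  iter m (ad Z) (\sum_(i <- r) f i) = \sum_(i <- r) iter m (ad Z) (f i).
Proof. exact: (big_morph _ (iter_adD Z m) (iter_ad0 Z m)). Qed.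

Lemma iter_adN Z m v : iter m (ad (- Z)) v = (-1) ^+ m *: iter m (ad Z) v.
Proof.
elim: m => [|m IH]; first by rewrite expr0 scale1r.
rewrite !iterS IH adZ exprS -scalerA scaleN1r -scalerN; congr (_ *: _).
by rewrite /ad mulNr mulrN opprK opprB addrC.
Qed.

(* Binomial expansion: right multiplication by [Z] is left multiplication minus [ad Z]. *)
Lemma mul_expr_ad Z v m :
  v * Z ^+ m = \sum_(i < m.+1) ((-1) ^+ i * 'C(m, i)%:R) *: (Z ^+ (m - i) * iter i (ad Z) v).
Proof.
elim: m v => [|m IH] v.
  by rewrite big_ord1 !expr0 mulr1 mul1r bin0 mul1r scale1r.
have vZ : v * Z = Z * v - ad Z v by rewrite /ad opprB addrC subrK.
rewrite exprS mulrA vZ mulrBl -mulrA !IH [RHS]big_ord_recl.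
rewrite /= bin0 subn0 expr0 mul1r scale1r.
have -> : Z * \sum_(i < m.+1) ((-1) ^+ i * 'C(m, i)%:R) *: (Z ^+ (m - i) * iter i (ad Z) v)
  = Z ^+ m.+1 * v + \sum_(i < m.+1) ((-1) ^+ i.+1 * 'C(m, i.+1)%:R)
       *: (Z ^+ (m - i) * iter i.+1 (ad Z) v).
  rewrite big_ord_recl big_ord_recr /= bin0 subn0 expr0 mul1r scale1r.
  rewrite bin_small// mulr0 scale0r addr0 mulrDr mulrA -exprS; congr (_ + _).
  rewrite mulr_sumr; apply: eq_bigr => i _.
  by rewrite -scalerAr mulrA -exprS /bump leq0n add1n -subSn// subSS.
rewrite -addrA -sumrB; congr (_ + _); apply: eq_bigr => i _.
rewrite /bump leq0n add1n subSS -iterSr -scalerBl; congr (_ *: _).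
by rewrite binS natrD exprS mulrDr !mulN1r !mulNr.
Qed.

(** The full exponential series when [upper 1 Z], since then [Z^(n+1) = 0]. *)
Definition expm Z : A := \sum_(m < n.+1) (m`!%:R)^-1 *: Z ^+ m.

Lemma expmV Z : upper 1 Z -> expm (- Z) * expm Z = 1.
Proof.
move=> HZ; rewrite /expm mulr_suml.
under eq_bigr => i _ do rewrite mulr_sumr.
rewrite (@triangular_sum _ n.+1 (fun i j =>
  (i`!%:R^-1 *: (- Z) ^+ i) * (j`!%:R^-1 *: Z ^+ j))); last first.
  move=> i j ij; rewrite -scalerAr -scalerAl (@upper_eq0 (i + j) ((- Z) ^+ i * Z ^+ j)) ?scaler0//.
  by apply: upperM; apply: upperX => //; apply: upperN.
(* The part of total degree [k] is the binomial expansion of [(Z - Z)^k / k!]. *)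
have E k : \sum_(i < k.+1) (i`!%:R^-1 *: (- Z) ^+ i) * ((k - i)`!%:R^-1 *: Z ^+ (k - i))
  = (k`!%:R)^-1 *: (Z - Z) ^+ k.
  rewrite (@exprDn_comm _ Z (- Z)); last by rewrite /GRing.comm mulrN mulNr.
  rewrite scaler_sumr; apply: eq_bigr => i _.
  have ik : (i <= k)%N by rewrite -ltnS.
  rewrite -scalerAr -scalerAl scalerA -scaler_nat scalerA.
  have -> : (- Z) ^+ i * Z ^+ (k - i) = Z ^+ (k - i) * (- Z) ^+ i.
    by apply: commrX; apply: commr_sym; apply: commrX; rewrite /GRing.comm mulrN mulNr.
  congr (_ *: _); rewrite -(bin_fact ik) !natrM; field.
  by rewrite !factr_neq0 pnatr_eq0 -lt0n bin_gt0 ik.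
under eq_bigr => k _ do rewrite E subrr.
rewrite big_ord_recl expr0 fact0 invr1 scale1r big1 ?addr0// => i _.
by rewrite expr0n scaler0.
Qed.

Section Derivation.
Variable T : A.
Hypothesis HT : upper 0 T.
Definition der M := M * T - T * M.

Lemma derM M N : der (M * N) = der M * N + M * der N.
Proof. by rewrite /der mulrBl mulrBr !mulrA [RHS]addrC addrA subrK. Qed.

Lemma derD : {morph der : M N / M + N}.
Proof. by move=> u v; rewrite /der mulrDr mulrDl opprD addrACA. Qed.

Lemma der0 : der 0 = 0.
Proof. by rewrite /der mulr0 mul0r subrr. Qed.

Lemma der1 : der 1 = 0.
Proof. by rewrite /der mulr1 mul1r subrr. Qed.

Lemma derN M : der (- M) = - der M.
Proof. by rewrite /der mulrN mulNr opprB opprK addrC. Qed.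

Lemma derZ a M : der (a *: M) = a *: der M.
Proof. by rewrite /der -scalerAr -scalerAl scalerBr. Qed.

Lemma der_sum (I : Type) (r : seq I) (f : I -> A) :
  der (\sum_(i <- r) f i) = \sum_(i <- r) der (f i).
Proof. exact: (big_morph _ derD der0). Qed.

Lemma upper_der d M : upper d M -> upper d (der M).
Proof.
by move=> HM; apply: upperB; [rewrite -[d]addn0|rewrite -[d]add0n]; apply: upperM.
Qed.

(** Induction by the Leibniz rule: [mul_expr_ad] moves the powers of [Z] to the left of [der Z], and
    the coefficients add up by Pascal's rule. *)
Lemma der_expr Z m : der (Z ^+ m.+1) =
  \sum_(i < m.+1) ((-1) ^+ i * 'C(m.+1, i.+1)%:R) *: (Z ^+ (m - i) * iter i (ad Z) (der Z)).
Proof.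
elim: m => [|m IH].
  by rewrite big_ord1 expr1 !expr0 !mul1r binn scale1r.
rewrite exprS derM IH mul_expr_ad mulr_sumr.
rewrite [X in _ + X](_ : _ = \sum_(i < m.+2) ((-1) ^+ i * 'C(m.+1, i.+1)%:R)
   *: (Z ^+ (m.+1 - i) * iter i (ad Z) (der Z))); last first.
  rewrite [RHS]big_ord_recr /= bin_small// mulr0 scale0r addr0.
  by apply: eq_bigr => i _; rewrite -scalerAr mulrA -exprS -subSn// -ltnS.
rewrite -big_split; apply: eq_bigr => i _ /=.
by rewrite -scalerDl; congr (_ *: _); rewrite [in RHS]binS natrD -mulrDr addrC.
Qed.

(** The formula [D (e^Z) = e^Z ((1 - e^(- ad Z)) / ad Z) (D Z)], obtained by summing [der_expr] over
    all powers and regrouping by the power of [ad Z]. *)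
Lemma der_expm Z : upper 1 Z ->
  der (expm Z) = expm Z * \sum_(i < n.+1) ((-1) ^+ i / i.+1`!%:R) *: iter i (ad Z) (der Z).
Proof.
move=> HZ; pose f i p := ((-1) ^+ i / (i.+1`!%:R * p`!%:R)) *:
   (Z ^+ p * iter i (ad Z) (der Z)).
(* Besides the [i + p] factors [Z], [der Z] itself contributes one step above the diagonal, so total
   degree [n] already vanishes. *)
have f0 i p : (n <= i + p)%N -> f i p = 0.
  move=> ip; rewrite /f (@upper_eq0 (p + (i + 1)) (_ * _)) ?scaler0//; first by lia.
  by apply: upperM; [exact: upperX|apply: upper_iter_ad => //; exact: upper_der].
have -> : expm Z * \sum_(i < n.+1) ((-1) ^+ i / i.+1`!%:R) *: iter i (ad Z) (der Z)
  = \sum_(i < n.+1) \sum_(p < n.+1) f i p.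
  rewrite mulr_sumr; apply: eq_bigr => i _; rewrite mulr_suml; apply: eq_bigr => p _.
  by rewrite -scalerAr -scalerAl scalerA /f; congr (_ *: _); rewrite invfM mulrA.
rewrite triangular_sum; last by move=> i j /ltnW; apply: f0.
(* Dropping the diagonal [i + p = n] leaves diagonals [k < n], matching the powers [Z^(k+1)] on the
   left. *)
rewrite big_ord_recr /= [X in _ + X]big1 ?addr0; last first.
  by move=> i _; apply: f0; rewrite subnKC// -ltnS.
rewrite /expm der_sum big_ord_recl expr0 derZ der1 scaler0 add0r.
apply: eq_bigr => k _; rewrite derZ lift0 der_expr scaler_sumr.
apply: eq_bigr => i _; rewrite /f scalerA; congr (_ *: _).
have ik : (i.+1 <= k.+1)%N by [].
have hC : 'C(k.+1, i.+1)%:R != 0 :> F by rewrite pnatr_eq0 -lt0n bin_gt0.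
rewrite -(bin_fact ik) subSS natrM (natrM _ i.+1`!).
move: (factr_neq0 F i.+1) (factr_neq0 F (k - i)) hC.
move: (i.+1`!%:R) ((k - i)`!%:R) ('C(k.+1, i.+1)%:R) => a b d ha hb hd.
by field; rewrite ha hb.
Qed.

(** The hypothesis on [c] says that [sum_k c_k s^k] is inverse to [(1 - e^(-s)) / s]. By [der_expm],
    [y] is the latter series in [ad Z] applied to [der Z], so applying the inverse recovers
    [der Z]. *)
Lemma der_log_right (c : nat -> F) Z y :
  (forall k, \sum_(i < k.+1) c i * ((-1) ^+ (k - i) / (k - i).+1`!%:R) = (k == 0)%:R) ->
  upper 1 Z -> der (expm Z) = expm Z * y ->
  der Z = \sum_(i < n.+1) c i *: iter i (ad Z) y.
Proof.
move=> Hc HZ; rewrite der_expm// => /(congr1 ( *%R (expm (- Z)))).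
rewrite !mulrA expmV// !mul1r => <-.
pose f i j := (c i * ((-1) ^+ j / j.+1`!%:R)) *: iter (i + j) (ad Z) (der Z).
transitivity (\sum_(i < n.+1) \sum_(j < n.+1) f i j); last first.
  apply: eq_bigr => i _; rewrite iter_ad_sum scaler_sumr; apply: eq_bigr => j _.
  by rewrite iter_adZ scalerA -iterD.
rewrite triangular_sum; last first.
  move=> i j ij; rewrite /f (@upper_eq0 (i + j + 0) (iter _ _ _)) ?scaler0//; first by rewrite addn0.
  by apply: upper_iter_ad => //; apply: upper_der; apply: upperW HZ.
rewrite [RHS](eq_bigr (fun k : 'I_n.+1 => (val k == 0)%:R *: iter k (ad Z) (der Z))).
  rewrite big_ord_recl /= scale1r big1 ?addr0// => i _.
  by rewrite scale0r.
move=> k _; rewrite -Hc scaler_suml; apply: eq_bigr => i _.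
by rewrite /f subnKC// -ltnS.
Qed.

(* The right-hand version applied to [- Z]. *)
Lemma der_log_left (c : nat -> F) Z x :
  (forall k, \sum_(i < k.+1) c i * ((-1) ^+ (k - i) / (k - i).+1`!%:R) = (k == 0)%:R) ->
  upper 1 Z -> der (expm Z) = x * expm Z ->
  der Z = \sum_(i < n.+1) ((-1) ^+ i * c i) *: iter i (ad Z) x.
Proof.
move=> Hc HZ dZ.
have HNZ : upper 1 (- Z) by apply: upperN.
have ZV : expm Z * expm (- Z) = 1 by rewrite -{1}(opprK Z) expmV.
have dN : der (expm (- Z)) = expm (- Z) * - x.
  have : der (expm (- Z) * expm Z) = 0 by rewrite expmV// der1.
  rewrite derM dZ => /(congr1 ( *%R^~ (expm (- Z)))).
  rewrite mul0r mulrDl -!mulrA ZV !mulr1 => /eqP; rewrite addr_eq0 => /eqP->.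
  by rewrite mulrN.
have := der_log_right Hc HNZ dN; rewrite derN => /eqP; rewrite eqr_oppLR => /eqP->.
rewrite -sumrN; apply: eq_bigr => i _.
rewrite -[LHS]scaleN1r iter_adN -(scaleN1r x) iter_adZ !scalerA.
by congr (_ *: _); ring.
Qed.
End Derivation.
End LogDerivative.

(** * Words as triangular matrices *)

Section WordMatrices.
Local Open Scope ring_scope.
Variables (F : numFieldType) (w : seq bool).
Local Notation n := (size w).
Local Notation A := 'M[F]_n.+1.
Implicit Types (M N v : A).

(** Reading [c] advances from position [k] of [w] to [k + 1], so a product of letters has corner
    entry 1 exactly when it spells [w]. The default of [nth] is never read: [l = k + 1] forces
    [k < n]. *)
Definition letter (c : bool) : A :=
  \matrix_(k, l) ((l == k.+1 :> nat) && (nth true w k == c))%:R.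

Definition cnt (c : bool) (k : nat) := count_mem c (take k w).

Lemma cntS c k : (k < n)%N -> cnt c k.+1 = (cnt c k + (nth true w k == c))%N.
Proof. by move=> kn; rewrite /cnt (take_nth true) // -cats1 count_cat /= addn0. Qed.

Lemma leq_cnt c k l : (k <= l)%N -> (cnt c k <= cnt c l)%N.
Proof.
move=> kl; rewrite /cnt -(subnKC kl) takeD count_cat.
by rewrite leq_addr.
Qed.

Lemma cnt_add k : (k <= n)%N -> (cnt false k + cnt true k = k)%N.
Proof.
elim: k => [|k IH] kn; first by rewrite /cnt take0.
rewrite !cntS// -[in RHS](IH (ltnW kn)); case: (nth true w k) => /=; lia.
Qed.

Lemma letter_neq0 c k l : letter c k l != 0 ->
  [/\ (k < n)%N, l = k.+1 :> nat & nth true w k = c].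
Proof.
rewrite mxE; case: andP => [[/eqP lk /eqP kc] _|_]; last by rewrite eqxx.
by split => //; rewrite -ltnS -lk ltn_ord.
Qed.

Lemma upper_letter c : upper 1 (letter c).
Proof.
move=> k l lt; apply/eqP; apply: contraTT lt => /letter_neq0[_ -> _].
by rewrite addn1 ltnn.
Qed.

(** Makes the letter-counting derivation inner: the commutator with this matrix multiplies entry
    [(k, l)], for [k <= l], by the number of [c] in [w] between [k] and [l]. *)
Definition cntmx (c : bool) : A := diag_mx (\row_k (cnt c k)%:R).

Lemma upper_cntmx c : upper 0 (cntmx c).
Proof.
by move=> k l; rewrite addn0 !mxE; case: eqP => // ->; rewrite ltnn.
Qed.

Lemma der_cntmxE c M k l : der (cntmx c) M k l = ((cnt c l)%:R - (cnt c k)%:R) * M k l.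
Proof.
rewrite /der /cntmx !mxE mulrBl; congr (_ - _).
  rewrite (bigD1 l)//= !mxE eqxx mulr1n big1 ?addr0 1?mulrC// => i il.
  by rewrite !mxE (negbTE il) mulr0n mulr0.
rewrite (bigD1 k)//= !mxE eqxx mulr1n big1 ?addr0// => i il.
by rewrite !mxE eq_sym (negbTE il) mulr0n mul0r.
Qed.

Lemma der_letter c c' : der (cntmx c) (letter c') = (c == c')%:R *: letter c'.
Proof.
apply/matrixP => k l; rewrite der_cntmxE [RHS]mxE.
have [->|/letter_neq0[kn lk kc]] := eqVneq (letter c' k l) 0; first by rewrite !mulr0.
by rewrite lk cntS// natrD addrC addKr kc eq_sym.
Qed.

Lemma ad_id (Z : A) : ad Z Z = 0.
Proof. exact: subrr. Qed.

(** The derivative of a letter is a multiple of that letter and commutes with it, so only the term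
    [i = 0] of [der_expm] survives. *)
Lemma der_expm_letter c c' :
  der (cntmx c) (expm (letter c')) = (c == c')%:R *: (expm (letter c') * letter c').
Proof.
rewrite der_expm; [|exact: upper_cntmx|exact: upper_letter].
rewrite der_letter scalerAr; congr (_ * _).
rewrite big_ord_recl /= !expr0 divr1 scale1r big1 ?addr0// => i _.
by rewrite add0n -iterS iterSr adZ ad_id scaler0 iter_ad0 scaler0.
Qed.

Lemma expm_comm (Z : A) : expm Z * Z = Z * expm Z.
Proof.
rewrite /expm mulr_suml mulr_sumr; apply: eq_bigr => i _.
by rewrite -scalerAl -scalerAr -exprS -exprSr.
Qed.

(** * The logarithm of [e^x e^y] and its bihomogeneous components *)

Definition expprod : A := expm (letter false) * expm (letter true).

Definition logU : A := expprod - 1.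

Definition logprod : A := \sum_(i < n) ((-1) ^+ i / i.+1%:R) *: logU ^+ i.+1.

Lemma upper_expm_sub1 (Z : A) : upper 1 Z -> upper 1 (expm Z - 1).
Proof.
move=> HZ; rewrite /expm big_ord_recl expr0 fact0 invr1 scale1r addrC addKr.
apply: upper_sum => i; apply: upperZ; apply: (@upperW _ _ _ (lift ord0 i)) => //.
exact: upperX.
Qed.

Lemma upper_expm (Z : A) : upper 1 Z -> upper 0 (expm Z).
Proof.
move=> /upper_expm_sub1 H; rewrite -[expm Z](subrK 1); apply: upperD.
  exact: upperW H.
exact: upper1.
Qed.

Lemma upper_logU : upper 1 logU.
Proof.
have -> : logU = (expm (letter false) - 1) * expm (letter true) + (expm (letter true) - 1).
  by rewrite /logU /expprod mulrBl mul1r addrA subrK.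
apply: upperD; last exact/upper_expm_sub1/upper_letter.
rewrite -[1%N]addn0; apply: upperM; first exact/upper_expm_sub1/upper_letter.
exact/upper_expm/upper_letter.
Qed.

Lemma upper_logprod : upper 1 logprod.
Proof.
apply: upper_sum => i; apply: upperZ; apply: (@upperW _ _ _ i.+1) => //.
by apply: upperX; apply: upper_logU.
Qed.

Lemma expm_logprod : expm logprod = expprod.
Proof.
rewrite /expm /logprod explog_nilpotent; first by rewrite addrC subrK.
by apply: (@upper_eq0 _ _ n.+1) => //; apply: upperX; apply: upper_logU.
Qed.

Section LogProdDerivative.
Variable c : nat -> F.
Hypothesis Hc : forall k,
  \sum_(i < k.+1) c i * ((-1) ^+ (k - i) / (k - i).+1`!%:R) = (k == 0)%:R.

Lemma der_true_logprod : der (cntmx true) logprod =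
  \sum_(i < n.+1) c i *: iter i (ad logprod) (letter true).
Proof.
apply: der_log_right => //; [exact: upper_cntmx|exact: upper_logprod|].
rewrite expm_logprod /expprod derM !der_expm_letter scale0r mul0r add0r scale1r.
by rewrite mulrA.
Qed.

(** Counting x instead of y gives [D (e^z) = x e^z], whence the left-hand formula. *)
Lemma der_false_logprod : der (cntmx false) logprod =
  \sum_(i < n.+1) ((-1) ^+ i * c i) *: iter i (ad logprod) (letter false).
Proof.
apply: der_log_left => //; [exact: upper_cntmx|exact: upper_logprod|].
rewrite expm_logprod /expprod derM !der_expm_letter scale0r mulr0 addr0 scale1r.
by rewrite expm_comm mulrA.
Qed.
End LogProdDerivative.

(* Entry [(k, l)] stands for the factor of [w] between positions [k] and [l]; [pi i j] keeps
   the entries whose factor has [i] letters x (false) and [j] letters y (true). *)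
Definition bideg (i j : nat) (k l : nat) :=
  (cnt false l == cnt false k + i)%N && (cnt true l == cnt true k + j)%N.

Definition pi i j M : A := \matrix_(k, l) (if bideg i j k l then M k l else 0).

Lemma piD i j : {morph pi i j : M N / M + N}.
Proof. by move=> M N; apply/matrixP => k l; rewrite !mxE; case: ifP; rewrite ?addr0. Qed.

Lemma pi0 i j : pi i j 0 = 0.
Proof. by apply/matrixP => k l; rewrite !mxE; case: ifP. Qed.

Lemma piZ i j a M : pi i j (a *: M) = a *: pi i j M.
Proof. by apply/matrixP => k l; rewrite !mxE; case: ifP; rewrite ?mulr0. Qed.

Lemma piN i j M : pi i j (- M) = - pi i j M.
Proof. by apply/matrixP => k l; rewrite !mxE; case: ifP; rewrite ?oppr0. Qed.

Lemma pi_sum i j (I : Type) (r : seq I) (f : I -> A) :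
  pi i j (\sum_(x <- r) f x) = \sum_(x <- r) pi i j (f x).
Proof. exact: (big_morph _ (piD i j) (pi0 i j)). Qed.

Lemma bideg_uniq i j i' j' k l : bideg i j k l -> bideg i' j' k l = (i' == i) && (j' == j).
Proof.
case/andP=> /eqP e1 /eqP e2; rewrite /bideg e1 e2 !eqn_add2l.
by rewrite [i' == i]eq_sym [j' == j]eq_sym.
Qed.

(** Triangularity restricts the intermediate index to [k <= m <= l], where the bidegrees of the two
    factors of [w] add up. *)
Lemma piM i j M N : upper 0 M -> upper 0 N ->
  pi i j (M * N) =
  \sum_(i1 < i.+1) \sum_(j1 < j.+1) pi i1 j1 M * pi (i - i1) (j - j1) N.
Proof.
move=> HM HN; apply/matrixP => k l.
rewrite summxE.
under eq_bigr => i1 _ do rewrite summxE.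
under eq_bigr => i1 _ do under eq_bigr => j1 _ do rewrite mxE.
under eq_bigr => i1 _ do rewrite exchange_big /=.
rewrite exchange_big /= mxE.
have -> : (if bideg i j k l then (M * N) k l else 0) =
  \sum_m (if bideg i j k l then M k m * N m l else 0).
  by case: ifP => _; rewrite ?mxE// big1.
apply: eq_bigr => m _.
have [lt|km] := ltnP m k.
  rewrite HM ?addn0// mul0r if_same big1// => i1 _; rewrite big1// => j1 _.
  by rewrite !mxE HM ?addn0// if_same mul0r.
have [lt|ml] := ltnP l m.
  rewrite HN ?addn0// mulr0 if_same big1// => i1 _; rewrite big1// => j1 _.
  by rewrite !mxE HN ?addn0// if_same mulr0.
have cf1 := leq_cnt false km; have cf2 := leq_cnt false ml.
have ct1 := leq_cnt true km; have ct2 := leq_cnt true ml.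
case: ifP => [/andP[/eqP e1 /eqP e2]|nb]; last first.
  rewrite big1// => i1 _; rewrite big1// => j1 _; rewrite !mxE.
  case: ifP => [/andP[/eqP e1 /eqP e2]|]; last by rewrite mul0r.
  case: ifP => [/andP[/eqP e3 /eqP e4]|]; last by rewrite mulr0.
  move/negP: nb; case; rewrite /bideg e3 e4 e1 e2 -!addnA !subnKC ?eqxx// -ltnS//.
(* The only contributing pair [(i1, j1)] is the bidegree of the factor of [w] from [k] to [m]. *)
have h1 : (cnt false m - cnt false k < i.+1)%N by lia.
have h2 : (cnt true m - cnt true k < j.+1)%N by lia.
have b1 : bideg (Ordinal h1) (Ordinal h2) k m by rewrite /bideg /= !subnKC ?eqxx.
rewrite (bigD1 (Ordinal h1))//= (bigD1 (Ordinal h2))//= !mxE b1.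
have -> : bideg (i - (cnt false m - cnt false k)) (j - (cnt true m - cnt true k)) m l.
  by rewrite /bideg; lia.
rewrite !big1 ?addr0// => [i1 ni|j1 nj].
  rewrite big1// => j1 _; rewrite !mxE (bideg_uniq _ _ b1).
  by move: ni; rewrite -val_eqE /= => /negbTE->; rewrite mul0r.
rewrite !mxE (bideg_uniq _ _ b1).
by move: nj; rewrite -val_eqE /= => /negbTE->; rewrite andbF mul0r.
Qed.

(** Indexes the sum by the bidegree of the right factor, as the term [v * Z] of [ad Z v]
    requires. *)
Lemma piM_rev i j M N : upper 0 M -> upper 0 N ->
  pi i j (M * N) =
  \sum_(i1 < i.+1) \sum_(j1 < j.+1) pi (i - i1) (j - j1) M * pi i1 j1 N.
Proof.
move=> HM HN; rewrite piM// (reindex_inj rev_ord_inj); apply: eq_bigr => i1 _.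
rewrite (reindex_inj rev_ord_inj); apply: eq_bigr => j1 _ /=.
by rewrite !subSS !subKn// -ltnS.
Qed.

Lemma pi_ad i j (Z v : A) : upper 0 Z -> upper 0 v -> pi i j (ad Z v) =
  \sum_(i1 < i.+1) \sum_(j1 < j.+1) ad (pi i1 j1 Z) (pi (i - i1) (j - j1) v).
Proof.
move=> HZ Hv; rewrite /ad piD piN piM// piM_rev// -sumrB; apply: eq_bigr => i1 _.
by rewrite -sumrB.
Qed.

Lemma pi_der_true i j M : pi i j (der (cntmx true) M) = j%:R *: pi i j M.
Proof.
apply/matrixP => k l; rewrite [in LHS]mxE [in RHS]mxE [in RHS]mxE der_cntmxE.
case: ifP => [/andP[_ /eqP->]|]; last by rewrite mulr0.
by rewrite natrD addrC addKr.
Qed.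

Lemma pi_der_false i j M : pi i j (der (cntmx false) M) = i%:R *: pi i j M.
Proof.
apply/matrixP => k l; rewrite [in LHS]mxE [in RHS]mxE [in RHS]mxE der_cntmxE.
case: ifP => [/andP[/eqP-> _]|]; last by rewrite mulr0.
by rewrite natrD addrC addKr.
Qed.

Definition bihom i j M := forall k l : 'I_n.+1, ~~ bideg i j k l -> M k l = 0.

Lemma pi_bihom i j i' j' M : bihom i j M ->
  pi i' j' M = if (i' == i) && (j' == j) then M else 0.
Proof.
move=> H; apply/matrixP => k l; rewrite [in LHS]mxE.
have [b|nb] := boolP (bideg i j k l).
  by rewrite (bideg_uniq _ _ b); case: ifP => // _; rewrite mxE.
by rewrite H// if_same; case: ifP => _; rewrite ?H// mxE.
Qed.

Lemma bihomM i j i' j' M N : bihom i j M -> bihom i' j' N -> bihom (i + i') (j + j') (M * N).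
Proof.
move=> HM HN k l nb; rewrite mxE big1// => m _.
have [/andP[/eqP e1 /eqP e2]|b] := boolP (bideg i j k m); last by rewrite HM// mul0r.
rewrite HN ?mulr0//; apply: contra nb => /andP[/eqP e3 /eqP e4].
by rewrite /bideg e3 e4 e1 e2 !addnA !eqxx.
Qed.

Lemma bihom1 : bihom 0 0 1.
Proof.
move=> k l; rewrite mxE; case: eqP => [->|//].
by rewrite /bideg !addn0 !eqxx.
Qed.

Lemma bihom_letter c : bihom (~~ c) c (letter c).
Proof.
move=> k l nb; apply/eqP; apply: contraNT nb => /letter_neq0[kn lk kc].
by rewrite /bideg lk !cntS// kc; case: c kc => kc; rewrite !eqxx.
Qed.

Lemma bihomXY i j : bihom i j (letter false ^+ i * letter true ^+ j).
Proof.
have Hf : bihom i 0 (letter false ^+ i).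
  elim: i => [|i IH]; first exact: bihom1.
  by have := bihomM (@bihom_letter false) IH; rewrite -exprS.
have Ht : bihom 0 j (letter true ^+ j).
  elim: j => [|j IH]; first exact: bihom1.
  by have := bihomM (@bihom_letter true) IH; rewrite -exprS.
by have := bihomM Hf Ht; rewrite addn0.
Qed.

Lemma pi_letter c i j : pi i j (letter c) =
  if (i == ~~ c :> nat) && (j == c :> nat) then letter c else 0.
Proof. exact: pi_bihom (@bihom_letter c). Qed.

Lemma pi_logU i j : pi i j logU = if (i == 0)%N && (j == 0)%N then 0 else
  (i`!%:R * j`!%:R)^-1 *: (letter false ^+ i * letter true ^+ j).
Proof.
rewrite /logU piD piN (pi_bihom _ _ bihom1).
have -> : pi i j expprod = (i`!%:R * j`!%:R)^-1 *: (letter false ^+ i * letter true ^+ j).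
  have E : expprod = \sum_(a < n.+1) \sum_(b < n.+1) (a`!%:R * b`!%:R)^-1 *:
      (letter false ^+ a * letter true ^+ b).
    rewrite /expprod /expm mulr_suml; apply: eq_bigr => a _.
    rewrite mulr_sumr; apply: eq_bigr => b _.
    by rewrite -scalerAr -scalerAl scalerA invfM mulrC.
  rewrite E pi_sum; under eq_bigr => a _ do rewrite pi_sum.
  (* The exponents cut off in [expm] contribute nothing, so the formula holds for all [i] and
     [j]. *)
  have X0 c m : (n < m)%N -> letter c ^+ m = 0.
    by move=> nm; apply: (upper_eq0 nm); apply: upperX; apply: upper_letter.
  have [ni|in_] := ltnP n i.
    rewrite (X0 false i ni) mul0r scaler0 big1// => a _; rewrite big1// => b _.
    rewrite piZ (pi_bihom _ _ (@bihomXY _ _)) [i == a]gtn_eqF ?scaler0//.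
    by rewrite (leq_trans (ltn_ord a)).
  have [nj|jn] := ltnP n j.
    rewrite (X0 true j nj) mulr0 scaler0 big1// => a _; rewrite big1// => b _.
    rewrite piZ (pi_bihom _ _ (@bihomXY _ _)) [j == b]gtn_eqF ?andbF ?scaler0//.
    by rewrite (leq_trans (ltn_ord b)).
  have i1 : (i < n.+1)%N by [].
  have j1 : (j < n.+1)%N by [].
  rewrite (bigD1 (Ordinal i1))//= (bigD1 (Ordinal j1))//=.
  rewrite piZ (pi_bihom _ _ (@bihomXY _ _)) !eqxx /= !big1 ?addr0//.
    move=> a na; rewrite big1// => b _; rewrite piZ (pi_bihom _ _ (@bihomXY _ _)).
    by rewrite eq_sym; move: na; rewrite -val_eqE => /negbTE /= ->; rewrite scaler0.
  move=> b nb; rewrite piZ (pi_bihom _ _ (@bihomXY _ _)).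
  by rewrite [j == b]eq_sym; move: nb; rewrite -val_eqE => /negbTE /= ->; rewrite andbF scaler0.
case: ifP => [/andP[/eqP-> /eqP->]|_]; last by rewrite subr0.
by rewrite !expr0 mulr1 fact0 mulr1 invr1 scale1r subrr.
Qed.

(** Entries of bidegree [(i, j)] lie on the superdiagonal [i + j], by [cnt_add]. *)
Lemma pi_upper_gt i j d M : upper d M -> (i + j < d)%N -> pi i j M = 0.
Proof.
move=> HM lt; apply/matrixP => k l; rewrite !mxE; case: ifP => // /andP[/eqP e1 /eqP e2].
apply: HM; have := cnt_add (ltn_ord k); have := cnt_add (ltn_ord l); lia.
Qed.

Lemma pi_gt i j M : (n < i + j)%N -> pi i j M = 0.
Proof.
move=> lt; apply/matrixP => k l; rewrite !mxE; case: ifP => // /andP[/eqP e1 /eqP e2].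
have := cnt_add (ltn_ord k); have := cnt_add (ltn_ord l); have := ltn_ord l; lia.
Qed.

(** Makes the range of summation independent of [w] and equal to that of [Zpoly]: powers of [logU]
    beyond [i + j] have no component of bidegree [(i, j)]. *)
Lemma pi_logprod i j : pi i j logprod =
  \sum_(m < i + j) ((-1) ^+ m / m.+1%:R) *: pi i j (logU ^+ m.+1).
Proof.
have [lt|ge] := ltnP n (i + j).
  by rewrite pi_gt// big1// => m _; rewrite pi_gt// scaler0.
rewrite /logprod pi_sum.
rewrite [RHS](big_ord_widen n (fun m => ((-1) ^+ m / m.+1%:R) *: pi i j (logU ^+ m.+1)))//.
rewrite [RHS]big_mkcond; apply: eq_bigr => m _; rewrite piZ; case: ltnP => // h.
by rewrite (@pi_upper_gt _ _ m.+1) ?scaler0//; apply: upperX; apply: upper_logU.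
Qed.

Lemma pi_log_recursion_right (c : nat -> F) i j :
  (forall k, \sum_(i < k.+1) c i * ((-1) ^+ (k - i) / (k - i).+1`!%:R) = (k == 0)%:R) ->
  j%:R *: pi i j logprod =
    \sum_(k < n.+1) c k *: pi i j (iter k (ad logprod) (letter true)).
Proof.
move=> Hc; rewrite -pi_der_true (der_true_logprod Hc) pi_sum.
by apply: eq_bigr => k _; rewrite piZ.
Qed.

Lemma pi_log_recursion_left (c : nat -> F) i j :
  (forall k, \sum_(i < k.+1) c i * ((-1) ^+ (k - i) / (k - i).+1`!%:R) = (k == 0)%:R) ->
  i%:R *: pi i j logprod =
    \sum_(k < n.+1) ((-1) ^+ k * c k) *: pi i j (iter k (ad logprod) (letter false)).
Proof.
move=> Hc; rewrite -pi_der_false (der_false_logprod Hc) pi_sum.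
by apply: eq_bigr => k _; rewrite piZ.
Qed.

Definition wordmx (u : seq bool) : A := \prod_(c <- u) letter c.

Lemma wordmxE u (k l : 'I_n.+1) :
  wordmx u k l = ((k <= l)%N && (take (l - k) (drop k w) == u))%:R.
Proof.
elim: u k => [|c u IH] k.
  rewrite /wordmx big_nil mxE -val_eqE /=; congr (_%:R); congr nat_of_bool.
  have [-> |ne] := eqVneq (val k) (val l); first by rewrite leqnn subnn take0.
  apply/esym/negbTE; rewrite negb_and -ltnNge; case: ltnP => //= kl.
  have ln : (l <= n)%N by rewrite -ltnS.
  rewrite -size_eq0 size_takel ?size_drop ?leq_sub2r//.
  by rewrite subn_eq0 -ltnNge ltn_neqAle ne.
rewrite /wordmx big_cons -/(wordmx u) mxE.
have [kn|nk] := ltnP k n; last first.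
  rewrite big1; last first.
    move=> m _; have [->|/letter_neq0[]] := eqVneq (letter c k m) 0; first by rewrite mul0r.
    by rewrite ltnNge nk.
  by rewrite drop_oversize//= andbF.
have k1 : (k.+1 < n.+1)%N by [].
rewrite (bigD1 (Ordinal k1))//= IH mxE eqxx /= big1 ?addr0; last first.
  move=> m nm; rewrite mxE; move: nm; rewrite -val_eqE /= => /negbTE->.
  by rewrite mul0r.
rewrite -natrM mulnb; congr (_%:R); congr nat_of_bool.
rewrite (drop_nth true kn); case: (ltngtP k l) => kl; last 1 first.
- by rewrite kl subnn /= andbF.
- by rewrite -[(l - k)%N]prednK ?subn_gt0//= eqseq_cons subnS.
- by rewrite andbF.
Qed.
End WordMatrices.

(** * Bernoulli numbers *)

Section Bernoulli.
Import mathcomp.algebra_tactics.ring.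
Local Open Scope ring_scope.
Variable F : numFieldType.

(* [1 - u cot u = sum_k (cotc k) u^(2k)]: the recursion is the Riccati equation
   [u g' + g = u^2 + g^2] of this function; the first argument of [cotf] is fuel. *)
Fixpoint cotf (f n : nat) : F :=
  if f is f'.+1 then
    ((n == 1)%:R + \sum_(i < n.-1) cotf f' i.+1 * cotf f' (n.-1 - i)) / (n.*2.+1)%:R
  else 0.

Definition cotc n := cotf n n.

Lemma cotf_fuel f f' n : (n <= f)%N -> (n <= f')%N -> cotf f n = cotf f' n.
Proof.
elim: f f' n => [|f IH] [|f'] n //=; rewrite ?leqn0.
- by move=> /eqP-> _; rewrite big_ord0 addr0 mul0r.
- by move=> _ /eqP->; rewrite big_ord0 addr0 mul0r.
move=> nf nf'; congr ((_ + _) / _); apply: eq_bigr => i _.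
by have i_lt := ltn_ord i; congr (_ * _); apply: IH; lia.
Qed.

Lemma cotc0 : cotc 0 = 0. Proof. by []. Qed.

Lemma cotc_rec n : (n.*2.+1)%:R * cotc n =
  (n == 1)%:R + \sum_(i < n.+1) cotc i * cotc (n - i).
Proof.
case: n => [|n]; first by rewrite cotc0 mulr0 big_ord1 mulr0 addr0.
rewrite {1}/cotc /= mulrC divfK ?pnatr_eq0//; congr (_ + _).
(* The extreme terms of the full convolution contain [cotc 0 = 0], which leaves the sum used in
   [cotf]. *)
rewrite big_ord_recl big_ord_recr /= cotc0 mul0r add0r subnn cotc0 mulr0 addr0.
apply: eq_bigr => i _; have i_lt := ltn_ord i.
by rewrite /bump leq0n add1n subSS; congr (_ * _); apply: cotf_fuel; lia.
Qed.

Lemma cotc_ge0 n : 0 <= cotc n.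
Proof.
rewrite /cotc; move: {1}n => f; elim: f n => [|f IH] n //=.
by rewrite divr_ge0// addr_ge0// sumr_ge0// => i _; rewrite mulr_ge0.
Qed.

(* [z / (e^z - 1) = sum_n (bern n) z^n], read off [z/2 coth(z/2) - z/2]. *)
Definition bern n : F :=
  if n is 0 then 1 else if n is 1 then - 2^-1 else
  if odd n then 0 else - ((- 4^-1) ^+ n./2 * cotc n./2).

Lemma dvdXn_coef (p : {poly F}) m :
  (forall k, (k < m)%N -> p`_k = 0) -> exists t, p = t * 'X^m.
Proof.
move=> H; exists (drop_poly m p); rewrite -[LHS](poly_take_drop m).
rewrite [X in X + _](_ : _ = 0) ?add0r//; apply/polyP => k.
by rewrite coef_take_poly coef0; case: ltnP => // /H.
Qed.

Let a : {poly F} := (2^-1)%:P.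

(** [H] truncates [z/2 coth (z/2) - 1], that is [- (1 - u cot u)] at [u = i z / 2], and the Riccati
    equation becomes [z H' + H + H^2 = z^2 / 4] up to the truncation error. *)
Lemma riccati_cot m : exists t,
  let H : {poly F} := (\poly_(i < m) - ((- 4^-1) ^+ i * cotc i)) \Po 'X^2 in
  'X * H^`() + H + H ^+ 2 - a ^+ 2 * 'X ^+ 2 = t * 'X^(m.*2).
Proof.
pose h : {poly F} := \poly_(i < m) - ((- 4^-1) ^+ i * cotc i).
(* First in the variable that stands for [X^2]; the factor 2 comes from the chain rule. *)
have [t Et] : exists t, 'X * h^`() * 2%:R + h + h ^+ 2 - a ^+ 2 * 'X = t * 'X^m.
  apply: dvdXn_coef => k km.
  rewrite -!polyC_exp -mulrA mulr_natr !coefB !coefD coefCM coefX coefXM.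
  rewrite expr2 coefM [X in _ + X - _](_ : _ =
     (- 4^-1) ^+ k * \sum_(i < k.+1) cotc i * cotc (k - i)); last first.
    rewrite mulr_sumr; apply: eq_bigr => i _; have i_lt := ltn_ord i.
    rewrite !coef_poly (leq_ltn_trans (leq_subr _ _) km).
    have -> : (i < m)%N by lia.
    rewrite mulrNN mulrACA -exprD subnKC//.
  have -> : \sum_(i < k.+1) cotc i * cotc (k - i) = (k.*2.+1)%:R * cotc k - (k == 1)%:R.
    by rewrite cotc_rec addrC addKr.
  rewrite coefMn coef_deriv !coef_poly km; case: k km => [|k] km /=.
    by rewrite cotc0; ring.
  rewrite km -!mulrnA -[_ *+ (k.+1 * 2)]mulr_natr.
  have -> : (k.+1.*2.+1)%:R = 1 + (k.+1 * 2)%:R :> F by rewrite muln2 -natr1 addrC.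
  move: (cotc _) (_ * 2)%:R => x y.
  case: k {km} => [|k] /=; last by ring.
  by rewrite expr1; field.
exists (t \Po 'X^2) => H.
have -> : (t \Po 'X^2) * 'X^(m.*2) = (t * 'X^m) \Po 'X^2.
  by rewrite comp_polyM comp_Xn_poly -exprM mul2n.
rewrite -Et (expr2 h) (expr2 a) !(comp_polyB, comp_polyD, comp_polyM) comp_polyX comp_polyC.
rewrite /H deriv_comp derivXn /= -/h expr1.
by rewrite /a comp_polyC polyC1; ring.
Qed.

(* [B = z / (e^z - 1)] and [E = (e^z - 1) / z] satisfy [z B' = B - B^2 - z B] and
   [z E' = z E + 1 - E], so [v = 1 - B E] satisfies [z v' = - B v], which forces [v = 0]. *)
Lemma bern_rec k :
  \sum_(i < k.+1) bern i / (k - i).+1`!%:R = (k == 0)%:R.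
Proof.
pose m := k.+1.
have [t] := riccati_cot m; set H := _ \Po _ => /= Et.
pose B : {poly F} := 1 - a * 'X + H.
have Bb i : (i < m)%N -> B`_i = bern i.
  move=> im; rewrite /B /H !coefD coefN coefCM coefX coef1 coef_comp_poly_Xn// coef_poly.
  case: i im => [|[|i]] im /=.
  - by rewrite div0n /= expr0 cotc0 mulr0 oppr0 mulr0 subr0 addr0.
  - by rewrite mulr1 sub0r addr0.
  rewrite mulr0 subrr add0r /bern dvdn2 divn2 /= negbK.
  case: (odd i) => //=.
  by have -> : (i./2.+1 < m)%N by lia.
pose E : {poly F} := \poly_(i < m.*2) (i.+1`!%:R)^-1.
have [s Es] : exists s, 'X * E^`() - 'X * E - 1 + E = s * 'X^(m.*2).
  apply: dvdXn_coef => i im; rewrite !coefD !coefN !coefXM coef1 coef_deriv !coef_poly im.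
  case: i im => [|i] im /=; first by rewrite !subr0 sub0r invr1 addNr.
  rewrite im (ltnW im) subr0 addrAC -mulrSr (factS i.+1) natrM invfM -[_ *+ i.+2]mulr_natl.
  by rewrite mulVKf ?subrr// pnatr_eq0.
have a2 : a + a = 1.
  by rewrite /a -polyCD -polyC1; congr (_%:P); field.
have B0 : B`_0 = 1 by rewrite Bb.
have XB : 'X * B^`() = B - B ^+ 2 - 'X * B + t * 'X^(m.*2).
  rewrite /B !derivE; move: Et; move: H^`() t 'X^(m.*2) => H' t' u Et.
  have -> : t' * u = 'X * H' + H + H ^+ 2 - a ^+ 2 * 'X^2 by rewrite -Et.
  apply/eqP; rewrite -subr_eq0; apply/eqP.
  (* [ring] sees [a] as an atom, so the use of [a + a = 1] is made explicit as a factor. *)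
  transitivity ((a + a - 1) * ('X * (a * 'X - 1 - H))); last by rewrite a2 subrr mul0r.
  by ring.
have [q Eq] : exists q, 'X * (1 - B * E)^`() = - B * (1 - B * E) + q * 'X^(m.*2).
  exists (- t * E - B * s).
  move: B E {Bb B0} XB Es => B' E' XB Es; move: XB Es; move: 'X^(m.*2) => u XB Es.
  have -> : (- t * E' - B' * s) * u = - (t * u) * E' - B' * (s * u) by ring.
  rewrite -Es; have -> : t * u = 'X * B'^`() - (B' - B' ^+ 2 - 'X * B') by rewrite XB; ring.
  by rewrite !derivE; ring.
(* If the lower coefficients of [v] vanish, coefficient [i] of the equation reads [i v_i = - v_i],
   because [B] has constant term 1. *)
have V0 i : (i < m)%N -> (1 - B * E)`_i = 0.
  elim/ltn_ind: i => i IH im.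
  move/polyP/(_ i): Eq; move: (1 - B * E) IH => v IH.
  rewrite coefD coefMXn; have -> : (i < m.*2)%N by lia.
  rewrite addr0 coefXM mulNr coefN coefM big_ord_recl /= subn0 B0 mul1r big1; last first.
    by move=> j _; rewrite /bump leq0n add1n IH ?mulr0//; have := ltn_ord j; lia.
  rewrite addr0 coef_deriv; case: i im {IH} => [|i] im /=.
    by move=> /esym/eqP; rewrite oppr_eq0 => /eqP.
  by move=> /eqP; rewrite -addr_eq0 -mulrSr mulrn_eq0 => /eqP.
have := V0 k (ltnSn k); rewrite coefB coef1 => /eqP; rewrite subr_eq0 => /eqP->.
rewrite coefM; apply: eq_bigr => i _; have i_lt := ltn_ord i.
by rewrite Bb// coef_poly; have -> : (k - i < m.*2)%N by lia.
Qed.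

(** Coefficients of [z / (1 - e^(-z))], the inverse of the series appearing in [der_expm]. *)
Definition sbern k := (-1) ^+ k * bern k.

Lemma sbern_rec k :
  \sum_(i < k.+1) sbern i * ((-1) ^+ (k - i) / (k - i).+1`!%:R) = (k == 0)%:R.
Proof.
have -> : (k == 0)%:R = (-1) ^+ k * (k == 0)%:R :> F.
  by case: k => [|k]; rewrite ?mulr0// expr0 mulr1.
rewrite -bern_rec mulr_sumr; apply: eq_bigr => i _; have i_lt := ltn_ord i.
by rewrite /sbern mulrACA -exprD subnKC.
Qed.
End Bernoulli.

(** * Lie expressions as matrices *)

Section NCPolyLinear.
Local Open Scope ring_scope.
Variable V : lmodType R.
Implicit Types (p q : NCPoly) (Phi : seq bool -> V).

Definition linext Phi p : V := \sum_(t <- p) t.1 *: Phi t.2.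

Lemma coef_sumE p u : coef p u = \sum_(t <- p) (if t.2 == u then t.1 else 0).
Proof.
elim: p => [|t p IH]; first by rewrite big_nil.
rewrite big_cons -IH /=; congr (_ + _).
by case: List.list_eq_dec => [->|/eqP/negbTE->] //; rewrite eqxx.
Qed.

(** A word may occur several times in a formal sum; collecting terms over the finite set of all
    words of [p] and [q] leaves only coefficients. *)
Lemma linext_ext Phi p q : coef p =1 coef q -> linext Phi p = linext Phi q.
Proof.
move=> pq; pose s := undup [seq t.2 | t <- p ++ q].
have lin_s r : {subset [seq t.2 | t <- r] <= s} ->
    linext Phi r = \sum_(u <- s) coef r u *: Phi u.
  move=> rs; under eq_bigr => u _ do rewrite coef_sumE scaler_suml.
  rewrite exchange_big /= /linext big_seq [RHS]big_seq; apply: eq_bigr => t tr.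
  rewrite (bigD1_seq t.2) ?undup_uniq//=; last by apply/rs/map_f.
  by rewrite eqxx big1 ?addr0// => u ut; rewrite eq_sym (negbTE ut) scale0r.
rewrite !lin_s; first by apply: eq_bigr => u _; rewrite pq.
  by move=> u; rewrite mem_undup map_cat mem_cat => ->; rewrite orbT.
by move=> u; rewrite mem_undup map_cat mem_cat => ->.
Qed.

Lemma linext_cat Phi p q : linext Phi (p ++ q) = linext Phi p + linext Phi q.
Proof. exact: big_cat. Qed.

Lemma linext_scal Phi r p : linext Phi (pscal r p) = r *: linext Phi p.
Proof.
rewrite /linext /pscal big_map scaler_sumr; apply: eq_bigr => t _.
by rewrite scalerA.
Qed.

Lemma linext_flat_map Phi (T : Type) (f : T -> NCPoly) (s : seq T) :
  linext Phi (List.flat_map f s) = \sum_(x <- s) linext Phi (f x).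
Proof.
elim: s => [|x s IH]; first by rewrite /linext !big_nil.
by rewrite big_cons /= linext_cat IH.
Qed.

Lemma linext_mul Phi p q : linext Phi (pmul p q) =
  \sum_(s <- p) s.1 *: linext (fun u => Phi (s.2 ++ u)) q.
Proof.
rewrite /pmul linext_flat_map; apply: eq_bigr => s _.
rewrite /linext big_map scaler_sumr; apply: eq_bigr => t _ /=.
by rewrite scalerA.
Qed.

Lemma eq_linext Phi Phi' p : Phi =1 Phi' -> linext Phi p = linext Phi' p.
Proof. by move=> E; apply: eq_bigr => t _; rewrite E. Qed.
End NCPolyLinear.

Fixpoint LSum (n : nat) (f : nat -> LieExpr) : LieExpr :=
  if n is n'.+1 then LAdd (LSum n' f) (f n') else LZero.

Definition Lgen (c : bool) : LieExpr := if c then LY else LX.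

(* The component of bidegree [(i, j)] of [(ad Z)^k] applied to the letter [c], where
   [Z = sum e i j]. *)
Fixpoint Ladpow (e : nat -> nat -> LieExpr) (c : bool) (k i j : nat) : LieExpr :=
  if k is k'.+1 then
    LSum i.+1 (fun i1 => LSum j.+1 (fun j1 => LBr (e i1 j1) (Ladpow e c k' (i - i1) (j - j1))))
  else if (i == ~~ c :> nat) && (j == c :> nat) then Lgen c else LZero.

Lemma LadpowS e c k i j : Ladpow e c k.+1 i j =
  LSum i.+1 (fun i1 => LSum j.+1 (fun j1 => LBr (e i1 j1) (Ladpow e c k (i - i1) (j - j1)))).
Proof. by []. Qed.

Section WordEval.
Local Open Scope ring_scope.
Variable w : seq bool.
Local Notation n := (size w).
Local Notation A := 'M[R]_n.+1.
Local Notation Z := (logprod R w).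
Implicit Types p q : NCPoly.

Definition mxeval p : A := linext (wordmx R w) p.

Lemma wordmx_cat u v : wordmx R w (u ++ v) = wordmx R w u * wordmx R w v.
Proof. exact: big_cat. Qed.

(** The bridge from polynomials to matrices: the corner entry of [wordmx u] is 1 if [u = w] and 0
    otherwise. *)
Lemma coef_mxeval p : coef p w = mxeval p ord0 ord_max.
Proof.
rewrite coef_sumE /mxeval /linext summxE; apply: eq_bigr => t _.
rewrite mxE wordmxE /= subn0 drop0 take_size /= eq_sym.
by case: eqP; rewrite ?mulr1 ?mulr0.
Qed.

Lemma mxeval_mul p q : mxeval (pmul p q) = mxeval p * mxeval q.
Proof.
rewrite /mxeval linext_mul mulr_suml; apply: eq_bigr => s _.
rewrite -scalerAl; congr (_ *: _); rewrite mulr_sumr; apply: eq_bigr => t _.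
by rewrite wordmx_cat -scalerAr.
Qed.

Lemma mxeval_br e1 e2 :
  mxeval (toPoly (LBr e1 e2)) = ad (mxeval (toPoly e1)) (mxeval (toPoly e2)).
Proof.
rewrite /mxeval /= linext_cat linext_scal -!/(mxeval _) !mxeval_mul.
by rewrite scaleN1r.
Qed.

Lemma mxeval_sum m f : mxeval (toPoly (LSum m f)) = \sum_(i < m) mxeval (toPoly (f i)).
Proof.
elim: m => [|m IH]; first by rewrite /mxeval /linext big_nil big_ord0.
by rewrite big_ord_recr /= -IH; apply: linext_cat.
Qed.

Lemma mxeval_gen c : mxeval (toPoly (Lgen c)) = letter R w c.
Proof.
by case: c; rewrite /mxeval /linext /= big_seq1 /= scale1r /wordmx big_seq1.
Qed.

Lemma wordmx_repeat c m : wordmx R w (List.repeat c m) = letter R w c ^+ m.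
Proof.
elim: m => [|m IH]; first by rewrite /wordmx big_nil.
by rewrite exprS -IH /wordmx /= big_cons.
Qed.

Lemma Lseq_iota a m : List.seq a m = iota a m.
Proof. by elim: m a => //= m IH a; rewrite IH. Qed.

Lemma compsS m i j : comps m.+1 i j =
  List.flat_map (fun i1 => List.flat_map (fun j1 =>
    if (Nat.eqb i1 0 && Nat.eqb j1 0)%bool then [::]
    else [seq (i1, j1) :: t | t <- comps m (i - i1) (j - j1)])
  (List.seq 0 j.+1)) (List.seq 0 i.+1).
Proof. by []. Qed.

(** Expansion of [(e^x e^y - 1)^m]: a composition chooses one nonconstant monomial from each of the
    [m] factors. *)
Lemma sum_comps m i j :
  linext (wordmx R w) [seq ((den t)^-1, word t) | t <- comps m i j] = pi i j (logU R w ^+ m).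
Proof.
elim: m i j => [|m IH] i j.
  rewrite expr0 (pi_bihom _ _ (@bihom1 _ w)) /=.
  case: i j => [|i] [|j] //=; rewrite /linext ?big_nil// big_seq1 /= invr1 scale1r.
  by rewrite /wordmx big_nil.
rewrite exprS piM; last 2 first.
- by apply: (@upperW _ _ _ 1) => //; exact: upper_logU.
- by apply: (@upperW _ _ _ m) => //; apply: upperX; exact: upper_logU.
have mapfm (T : Type) (f : T -> seq (seq (nat * nat))) (s : seq T) :
    [seq ((den t)^-1, word t) | t <- List.flat_map f s] =
    List.flat_map (fun x => [seq ((den t)^-1, word t) | t <- f x]) s.
  by elim: s => //= x s IHs; rewrite map_cat IHs.
rewrite compsS.
rewrite mapfm linext_flat_map Lseq_iota.
rewrite -[iota 0 i.+1]/(index_iota 0 i.+1) big_mkord; apply: eq_bigr => i1 _.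
rewrite mapfm linext_flat_map Lseq_iota.
rewrite -[iota 0 j.+1]/(index_iota 0 j.+1) big_mkord; apply: eq_bigr => j1 _.
rewrite pi_logU -IH.
have -> : (Nat.eqb i1 0 && Nat.eqb j1 0)%bool = (i1 == 0%N :> nat) && (j1 == 0%N :> nat).
  by case: (nat_of_ord i1) (nat_of_ord j1) => [|?] [|?].
case: ifP => _; first by rewrite /linext big_nil mul0r.
rewrite /linext !big_map mulr_sumr; apply: eq_bigr => t _ /=.
rewrite -scalerAl -scalerAr scalerA !wordmx_cat !wordmx_repeat.
by rewrite !RmultE !invfM !INRE !factE.
Qed.

Lemma mxeval_Zpoly i j : mxeval (Zpoly i j) = pi i j Z.
Proof.
rewrite pi_logprod /mxeval /Zpoly linext_flat_map Lseq_iota.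
rewrite (iotaDl 1 0) big_map.
have big_iota0 N (f : nat -> A) : \sum_(x <- iota 0 N) f x = \sum_(x < N) f x.
  by rewrite -(big_mkord xpredT) /index_iota subn0.
rewrite big_iota0.
apply: eq_bigr => m _; rewrite -sum_comps /linext !big_map scaler_sumr.
apply: eq_bigr => t _; rewrite scalerA; congr (_ *: _).
transitivity (Rdiv (Rdiv (pow (- 1) (m.+1 + 1)) (INR m.+1)) (den t)); first by rewrite add1n.
rewrite !RdivE RpowE INRE addn1; congr (_ / _ / _).
by rewrite !exprS !mulN1r opprK.
Qed.

Lemma mxeval_ext p q : coef p =1 coef q -> mxeval p = mxeval q.
Proof. exact: linext_ext. Qed.

Lemma mxeval_adpow e c k i j :
  (forall i j, coef (toPoly (e i j)) =1 coef (Zpoly i j)) ->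
  mxeval (toPoly (Ladpow e c k i j)) = pi i j (iter k (ad Z) (letter R w c)).
Proof.
move=> He; elim: k i j => [|k IH] i j.
  rewrite /= pi_letter; case: ifP => _; first exact: mxeval_gen.
  by rewrite /mxeval /linext big_nil.
have uZ := @upper_logprod R w.
rewrite iterS pi_ad; last 2 first.
- exact: upperW uZ.
- by apply: (@upperW _ _ _ (k + 1)) => //; apply: upper_iter_ad => //; apply: upper_letter.
rewrite LadpowS mxeval_sum; apply: eq_bigr => i1 _; rewrite mxeval_sum.
apply: eq_bigr => j1 _; rewrite mxeval_br IH; congr ad.
by rewrite (mxeval_ext (He _ _)) mxeval_Zpoly.
Qed.
End WordEval.

Section CoefRecursion.
Local Open Scope ring_scope.
Variable e : nat -> nat -> LieExpr.
Hypothesis He : forall i j, coef (toPoly (e i j)) =1 coef (Zpoly i j).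

Lemma bideg_full w i j : bideg w i j 0 (size w) -> size w = (i + j)%N.
Proof.
move=> /andP[]; rewrite {2 4}/cnt take0 /= => /eqP e1 /eqP e2.
by rewrite -(cnt_add (leqnn (size w))) e1 e2.
Qed.

(** The matrix recursion stops at [|w|], this one at [i + j]. Either [w] has bidegree [(i, j)] and
    the bounds agree, or the corner entry of every [pi i j] is 0. *)
Lemma coef_recursion (c : nat -> R) (d : bool) i j :
  (forall w i j, (if d then j else i)%:R *: pi i j (logprod R w) =
    \sum_(k < (size w).+1) c k *: pi i j (iter k (ad (logprod R w)) (letter R w d))) ->
  coef (toPoly (LScal (INR (if d then j else i)) (e i j))) =1
  coef (toPoly (LSum (i + j).+1 (fun k => LScal (c k) (Ladpow e d k i j)))).
Proof.
move=> Hc w; rewrite !coef_mxeval mxeval_sum.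
rewrite /mxeval /= linext_scal -/(mxeval _ _) (mxeval_ext _ (@He _ _)) mxeval_Zpoly.
rewrite INRE Hc !summxE.
have E k : linext (wordmx R w) (pscal (c k) (toPoly (Ladpow e d k i j))) =
    c k *: pi i j (iter k (ad (logprod R w)) (letter R w d)).
  by rewrite linext_scal -/(mxeval _ _) mxeval_adpow.
under [RHS]eq_bigr => k _ do rewrite E.
have [/bideg_full<-//|nb] := boolP (bideg w i j 0 (size w)).
rewrite !big1// => k _; rewrite !mxE /= (negbTE nb) mulr0//.
Qed.

Lemma coef_recursion_right i j :
  coef (toPoly (LScal (INR j) (e i j))) =1
  coef (toPoly (LSum (i + j).+1 (fun k => LScal (sbern R k) (Ladpow e true k i j)))).
Proof.
apply: (@coef_recursion _ true) => w i' j'.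
exact: (@pi_log_recursion_right R w (@sbern R) i' j' (@sbern_rec R)).
Qed.

(** The sign [(-1)^k] of the left-hand formula cancels the one in [sbern]. *)
Lemma coef_recursion_left i j :
  coef (toPoly (LScal (INR i) (e i j))) =1
  coef (toPoly (LSum (i + j).+1 (fun k => LScal (bern R k) (Ladpow e false k i j)))).
Proof.
apply: (@coef_recursion _ false) => w i' j'.
rewrite (@pi_log_recursion_left R w (@sbern R) i' j' (@sbern_rec R)); apply: eq_bigr => k _.
by rewrite /sbern mulrA -exprMn mulrNN mulr1 expr1n mul1r.
Qed.
End CoefRecursion.

(** * The recursion in a Banach-Lie algebra *)

HB.instance Definition _ (X : BanachLie) := gen_eqMixin (bl_car X).
HB.instance Definition _ (X : BanachLie) := gen_choiceMixin (bl_car X).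

Section BanachLieLmodule.
Variable X : BanachLie.

Let add0 : left_id (@zero X) (@add X).
Proof. by move=> x; rewrite add_comm add_zero. Qed.

Let addN : left_inverse (@zero X) (@opp X) (@add X).
Proof. by move=> x; rewrite add_comm add_opp. Qed.

HB.instance Definition _ := GRing.isZmodule.Build (bl_car X)
  (@add_assoc X) (@add_comm X) add0 addN.

Let scalDl (v : X) : {morph (fun r => scal r v) : r s / (r + s)%R >-> (r + s)%R}.
Proof. by move=> r s; apply: scal_distr_r. Qed.

HB.instance Definition _ := GRing.Zmodule_isLmodule.Build R (bl_car X)
  (@scal_assoc X) (@scal_one X) (@scal_distr_l X) scalDl.
End BanachLieLmodule.

(** * Adjoint action of words and the Dynkin-Specht-Wever formula *)

Section BracketTheory.
Local Open Scope ring_scope.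
Variable X : BanachLie.

Lemma brDl (u v x : X) : br (u + v) x = br u x + br v x.
Proof. exact: br_add_l. Qed.

Lemma brDr (u v x : X) : br x (u + v) = br x u + br x v.
Proof. exact: br_add_r. Qed.

Lemma brZl (r : R) (u x : X) : br (r *: u) x = r *: br u x.
Proof. exact: br_scal_l. Qed.

Lemma brZr (r : R) (u x : X) : br x (r *: u) = r *: br x u.
Proof. exact: br_scal_r. Qed.

Lemma br0l (x : X) : br 0 x = 0.
Proof. by rewrite -(scale0r (0 : X)) brZl !scale0r. Qed.

Lemma br0r (x : X) : br x 0 = 0.
Proof. by rewrite -(scale0r (0 : X)) brZr !scale0r. Qed.

Lemma br_xx (x : X) : br x x = 0.
Proof. exact: br_alt. Qed.

Lemma br_antisym (u v : X) : br u v = - br v u.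
Proof.
have := br_xx (u + v); rewrite brDl !brDr !br_xx addr0 add0r => /eqP.
by rewrite addr_eq0 => /eqP.
Qed.

Lemma br_suml (I : Type) (r : seq I) (f : I -> X) (x : X) :
  br (\sum_(i <- r) f i) x = \sum_(i <- r) br (f i) x.
Proof. exact: (big_morph (fun u => br u x) (fun u v => brDl u v x) (br0l x)). Qed.

Lemma br_sumr (I : Type) (r : seq I) (f : I -> X) (x : X) :
  br x (\sum_(i <- r) f i) = \sum_(i <- r) br x (f i).
Proof. exact: (big_morph (br x) (fun u v => brDr u v x) (br0r x)). Qed.

Lemma br_leibniz (u v x : X) : br u (br v x) - br v (br u x) = br (br u v) x.
Proof.
have /eqP : br u (br v x) + (br v (br x u) + br x (br u v)) = 0 := @br_jacobi X u v x.
rewrite (br_antisym x u) (br_antisym x (br u v)) -[- br u x]scaleN1r brZr scaleN1r.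
by rewrite addrA subr_eq0 => /eqP.
Qed.

Variables a b : X.
Definition gen (c : bool) : X := if c then b else a.

Definition adword (u : seq bool) (v : X) : X := foldr (fun c v => br (gen c) v) v u.

(** The value at the empty word is a default: that word never occurs in [toPoly e]. *)
Fixpoint nested (u : seq bool) : X :=
  if u is c :: u' then (if u' is [::] then gen c else br (gen c) (nested u')) else 0.

Lemma adword_cat u1 u2 v : adword (u1 ++ u2) v = adword u1 (adword u2 v).
Proof. exact: foldr_cat. Qed.

Lemma nested_cat u1 u2 : u2 != [::] -> nested (u1 ++ u2) = adword u1 (nested u2).
Proof.
move=> nu; elim: u1 => //= c u1 <-.
by case: u1 => //=; case: u2 nu.
Qed.

Lemma adword_linext u (Phi : seq bool -> X) p :
  adword u (linext Phi p) = linext (fun s => adword u (Phi s)) p.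
Proof.
elim: u => //= c u ->; rewrite br_sumr; apply: eq_bigr => t _.
by rewrite brZr.
Qed.

(** By the Jacobi identity [ad] is a Lie morphism, so the commutator of two polynomials acts as the
    bracket of their values. *)
Lemma adword_toPoly e v : linext (fun u => adword u v) (toPoly e) = br (evalL a b e) v.
Proof.
elim: e v => [|||e1 IH1 e2 IH2|r e IH|e1 IH1 e2 IH2] v /=.
- by rewrite /linext big_seq1 scale1r.
- by rewrite /linext big_seq1 scale1r.
- by rewrite /linext big_nil br0l.
- by rewrite linext_cat IH1 IH2 -brDl.
- by rewrite linext_scal IH -brZl.
have E f1 f2 : (forall v, linext (fun u => adword u v) (toPoly f1) = br (evalL a b f1) v) ->
    (forall v, linext (fun u => adword u v) (toPoly f2) = br (evalL a b f2) v) ->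
    linext (fun u => adword u v) (pmul (toPoly f1) (toPoly f2)) =
    br (evalL a b f1) (br (evalL a b f2) v).
  move=> H1 H2; rewrite linext_mul -H1; apply: eq_bigr => s _; congr (_ *: _).
  rewrite -H2 adword_linext; apply: eq_linext => u; exact: adword_cat.
by rewrite linext_cat linext_scal !E// scaleN1r br_leibniz.
Qed.

Fixpoint monomial (e : LieExpr) : bool :=
  match e with
  | LX | LY => true
  | LBr e1 e2 => monomial e1 && monomial e2
  | _ => false
  end.

Fixpoint ldeg (e : LieExpr) : nat :=
  match e with
  | LX | LY => 1
  | LBr e1 e2 => ldeg e1 + ldeg e2
  | _ => 0
  end.

Lemma ldeg_gt0 e : monomial e -> (0 < ldeg e)%N.
Proof. by elim: e => //= e1 IH1 e2 IH2 /andP[/IH1 h _]; rewrite ltn_addr. Qed.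

Lemma size_toPoly_monomial e : monomial e ->
  forall t, t \in toPoly e -> size t.2 = ldeg e.
Proof.
elim: e => //= [_ t|_ t|e1 IH1 e2 IH2 /andP[m1 m2] t].
- by rewrite inE => /eqP->.
- by rewrite inE => /eqP->.
have mulP p q n1 n2 : (forall t, t \in p -> size t.2 = n1) ->
   (forall t, t \in q -> size t.2 = n2) -> forall t, t \in pmul p q -> size t.2 = (n1 + n2)%N.
  elim: p => //= s p IHp H1 H2 x; rewrite mem_cat => /orP[/mapP[y yq ->]|].
    by rewrite /= size_cat (H1 s) ?mem_head// (H2 y).
  by apply: IHp => // y yp; apply: H1; rewrite inE yp orbT.
rewrite mem_cat => /orP[|/mapP[y yq ->] /=].
  by apply: mulP; [exact: IH1|exact: IH2].
by rewrite addnC; apply: mulP yq; [exact: IH2|exact: IH1].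
Qed.

(* Dynkin-Specht-Wever: [nested] is compatible with the adjoint action of words, and a Lie
   polynomial acts on [X] as the bracket with its value. *)
Lemma nested_monomial e : monomial e ->
  linext nested (toPoly e) = (ldeg e)%:R *: evalL a b e.
Proof.
elim: e => //= [_|_|e1 IH1 e2 IH2 /andP[m1 m2]].
- by rewrite /linext big_seq1.
- by rewrite /linext big_seq1.
have E f1 f2 : monomial f2 -> linext nested (pmul (toPoly f1) (toPoly f2)) =
    br (evalL a b f1) (linext nested (toPoly f2)).
  move=> mf; rewrite linext_mul -adword_toPoly; apply: eq_bigr => s _; congr (_ *: _).
  rewrite adword_linext /linext big_seq [RHS]big_seq; apply: eq_bigr => t tf.
  rewrite nested_cat// -size_eq0 (size_toPoly_monomial mf tf) -lt0n.
  exact: ldeg_gt0.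
rewrite linext_cat linext_scal !E// IH1// IH2// !brZr natrD scalerDl scaleN1r.
by rewrite (br_antisym (evalL a b e2)) scalerN opprK addrC.
Qed.

(** Multilinear expansion into pure brackets, whose words all have the same length. Quantifying over
    [Phi] transports any linear functional of the words. *)
Lemma monomial_decomposition e : exists s : seq (R * LieExpr),
  [/\ all (fun x => monomial x.2) s,
      evalL a b e = \sum_(x <- s) x.1 *: evalL a b x.2 &
      forall Phi : seq bool -> X,
        linext Phi (toPoly e) = \sum_(x <- s) x.1 *: linext Phi (toPoly x.2)].
Proof.
elim: e => [|||e1 [s1 [m1 v1 l1]] e2 [s2 [m2 v2 l2]]|r e [s [m v l]]
  |e1 [s1 [m1 v1 l1]] e2 [s2 [m2 v2 l2]]].
- by exists [:: (1, LX)]; split=> // [|Phi]; rewrite big_seq1 scale1r.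
- by exists [:: (1, LY)]; split=> // [|Phi]; rewrite big_seq1 scale1r.
- by exists [::]; split=> // [|Phi]; rewrite ?/linext !big_nil.
- exists (s1 ++ s2); split=> [||Phi]; first by rewrite all_cat m1.
    by rewrite big_cat /= -v1 -v2.
  by rewrite big_cat /= -l1 -l2 linext_cat.
- exists [seq (r * x.1, x.2) | x <- s]; split=> [||Phi].
  + by rewrite all_map.
  + rewrite big_map /= v -[scal r _]/(r *: _) scaler_sumr.
    by apply: eq_bigr => x _; rewrite scalerA.
  rewrite big_map /= linext_scal l scaler_sumr.
  by apply: eq_bigr => x _; rewrite scalerA.
exists (flatten [seq [seq (x.1 * y.1, LBr x.2 y.2) | y <- s2] | x <- s1]); split=> [||Phi].
- elim: s1 m1 {v1 l1} => //= x s1 IH /andP[mx m1]; rewrite all_cat IH// andbT all_map.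
  by apply: sub_all m2 => y /= ->; rewrite mx.
- rewrite big_flatten big_map /= v1 br_suml; apply: eq_bigr => x _.
  rewrite big_map v2 br_sumr; apply: eq_bigr => y _ /=.
  by rewrite brZl brZr scalerA.
rewrite big_flatten big_map /= linext_cat linext_scal scaleN1r.
have E1 : linext Phi (pmul (toPoly e1) (toPoly e2)) = \sum_(x <- s1) \sum_(y <- s2)
    (x.1 * y.1) *: linext Phi (pmul (toPoly x.2) (toPoly y.2)).
  rewrite linext_mul -[LHS]/(linext (fun u => linext (fun u' => Phi (u ++ u')) _) _) l1.
  apply: eq_bigr => x _.
  under eq_linext => u do rewrite l2.
  under [RHS]eq_bigr => y _ do rewrite linext_mul -scalerA -/(linext (fun u => linext (fun u' => Phi (u ++ u')) _) _).
  rewrite -scaler_sumr; congr (_ *: _); rewrite /linext.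
  under eq_bigr => t _ do rewrite scaler_sumr.
  rewrite exchange_big; apply: eq_bigr => y _; rewrite scaler_sumr.
  by apply: eq_bigr => t _; rewrite !scalerA mulrC.
have E2 : linext Phi (pmul (toPoly e2) (toPoly e1)) = \sum_(x <- s1) \sum_(y <- s2)
    (x.1 * y.1) *: linext Phi (pmul (toPoly y.2) (toPoly x.2)).
  rewrite linext_mul -[LHS]/(linext (fun u => linext (fun u' => Phi (u ++ u')) _) _) l2.
  rewrite [RHS]exchange_big; apply: eq_bigr => y _.
  under eq_linext => u do rewrite l1.
  under [RHS]eq_bigr => x _ do rewrite linext_mul mulrC -scalerA -/(linext (fun u => linext (fun u' => Phi (u ++ u')) _) _).
  rewrite -scaler_sumr; congr (_ *: _); rewrite /linext.
  under eq_bigr => t _ do rewrite scaler_sumr.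
  rewrite exchange_big; apply: eq_bigr => x _; rewrite scaler_sumr.
  by apply: eq_bigr => t _; rewrite !scalerA mulrC.
rewrite E1 E2 -sumrB; apply: eq_bigr => x _; rewrite big_map -sumrB.
by apply: eq_bigr => y _ /=; rewrite linext_cat linext_scal scaleN1r scalerBr.
Qed.

(** On a pure bracket every word has length [ldeg], so the weight cancels the factor of
    [nested_monomial]; the rest is linearity. *)
Lemma evalL_linext e :
  evalL a b e = linext (fun u => (size u)%:R^-1 *: nested u) (toPoly e).
Proof.
have [s [m -> ->]] := monomial_decomposition e.
elim: s m => [|x s IH] /=; first by rewrite !big_nil.
move=> /andP[mx m]; rewrite !big_cons IH//; congr (_ *: _ + _).
have d0 : (ldeg x.2)%:R != 0 :> R by rewrite pnatr_eq0 -lt0n ldeg_gt0.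
apply: (scalerI d0); rewrite -nested_monomial// /linext big_seq [in RHS]big_seq.
rewrite scaler_sumr; apply: eq_bigr => t tx.
by rewrite (size_toPoly_monomial mx tx) !scalerA mulrAC divff// mul1r.
Qed.

(** Well-definedness of the morphism [u_(a,b)]: the right side of [evalL_linext] depends only on
    coefficients. *)
Lemma evalL_ext e e' : coef (toPoly e) =1 coef (toPoly e') -> evalL a b e = evalL a b e'.
Proof. by move=> E; rewrite !evalL_linext; apply: linext_ext. Qed.

Lemma evalL_sum m f : evalL a b (LSum m f) = \sum_(i < m) evalL a b (f i).
Proof.
by elim: m => [|m IH]; rewrite ?big_ord0// big_ord_recr /= -IH.
Qed.

(* The analogue of [Ladpow] in [X]; [y] has bidegree [(0, 1)]. *)
Fixpoint adpow (z : nat -> nat -> X) (y : X) (k i j : nat) : X :=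
  if k is k'.+1 then
    \sum_(i1 < i.+1) \sum_(j1 < j.+1) br (z i1 j1) (adpow z y k' (i - i1) (j - j1))
  else if (i == 0)%N && (j == 1)%N then y else 0.

Lemma evalL_adpow_true e k i j :
  evalL a b (Ladpow e true k i j) = adpow (fun i j => evalL a b (e i j)) b k i j.
Proof.
elim: k i j => [|k IH] i j; first by rewrite /=; case: ifP.
rewrite LadpowS evalL_sum; apply: eq_bigr => i1 _; rewrite evalL_sum.
by apply: eq_bigr => j1 _; rewrite /= IH.
Qed.

Lemma evalL_adpow_false e k i j :
  evalL a b (Ladpow e false k i j) = adpow (fun i j => evalL a b (e j i)) a k j i.
Proof.
elim: k i j => [|k IH] i j; first by rewrite /= andbC; case: ifP.
rewrite LadpowS evalL_sum [RHS]exchange_big; apply: eq_bigr => i1 _; rewrite evalL_sum.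
by apply: eq_bigr => j1 _; rewrite /= IH.
Qed.
End BracketTheory.

Section Recursion.
Local Open Scope ring_scope.
Variable X : BanachLie.

(** The second index is the counted one. Swapping the indices of [z] lets the same predicate serve
    the derivation counting x. *)
Definition cbhd_rec (c : nat -> R) (z : nat -> nat -> X) (y : X) :=
  z 0%N 0%N = 0 /\
  forall i j, j%:R *: z i j = \sum_(k < (i + j).+1) c k *: adpow z y k i j.

Lemma adpow_ext (z z' : nat -> nat -> X) y k i j :
  (forall i j, z i j = z' i j) -> adpow z y k i j = adpow z' y k i j.
Proof.
move=> E; elim: k i j => //= k IH i j; apply: eq_bigr => i1 _; apply: eq_bigr => j1 _.
by rewrite E IH.
Qed.

Lemma IsZval_cbhd_rec (a b : X) (z : nat -> nat -> X) :
  (forall i j, IsZval i j a b (z i j)) ->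
  cbhd_rec (@sbern R) z b /\ cbhd_rec (@bern R) (fun i j => z j i) a.
Proof.
(* A Lie expression for each [Z_(i,j)] is chosen, so that the recursion can be stated on
   expressions. *)
move=> Hz; pose e i j := sval (cid (Hz i j)).
have He i j : coef (toPoly (e i j)) =1 coef (Zpoly i j).
  by rewrite /e; case: cid => ? [].
have ze i j : z i j = evalL a b (e i j) by rewrite /e; case: cid => ? [].
have z00 : z 0%N 0%N = 0.
  rewrite ze -[0]/(evalL a b LZero); apply: evalL_ext => w; exact: He.
split; split=> // i j.
  have := evalL_ext a b (coef_recursion_right He i j).
  rewrite evalL_sum [evalL _ _ (LScal _ _)]/= -ze INRE => E; rewrite [LHS]E.
  apply: eq_bigr => k _; rewrite [LHS]/= evalL_adpow_true.
  by congr (_ *: _); apply: adpow_ext => *; rewrite -ze.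
have := evalL_ext a b (coef_recursion_left He j i).
rewrite evalL_sum [evalL _ _ (LScal _ _)]/= -ze INRE => E; rewrite [LHS]E addnC.
apply: eq_bigr => k _; rewrite [LHS]/= evalL_adpow_false.
by congr (_ *: _); apply: adpow_ext => *; rewrite -ze.
Qed.

(** In bidegrees [(0, j)] only multiples of [y] occur, so all brackets vanish and the term [k = 0]
    remains. It supplies the initial value of [normsum] at [t = 0]. *)
Lemma cbhd_rec_pure (c : nat -> R) (z : nat -> nat -> X) y j :
  c 0%N = 1 -> cbhd_rec c z y -> z 0%N j = if j == 1%N then y else 0.
Proof.
move=> c0 [z00 Hz]; elim/ltn_ind: j => -[|j] // IH.
have ad0 k m : (m <= j.+1)%N -> adpow z y k.+1 0 m = 0.
  elim: k m => [|k IHk] m mj; rewrite [adpow _ _ _ _ _]/= big_ord1 big1// => m1 _.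
    rewrite /=; case: eqP => [mm|]; last by rewrite br0r.
    have m1m : (m1 < m)%N by lia.
    rewrite IH; last by lia.
    by case: eqP => _; rewrite ?br0l ?br_xx.
  by rewrite -[X in br _ X]/(adpow z y k.+1 0 (m - m1)) IHk ?br0r//; lia.
have j0 : j.+1%:R != 0 :> R by rewrite pnatr_eq0.
apply: (scalerI j0); rewrite Hz add0n big_ord_recl c0 scale1r big1 ?addr0; last first.
  by move=> k _; rewrite lift0 ad0// scaler0.
rewrite /=; case: eqP => [[->]|_]; first by rewrite scale1r.
by rewrite scaler0.
Qed.
End Recursion.

(** * Norm majorants and the differential inequality *)

Section NormBounds.
Local Open Scope ring_scope.
Variable X : BanachLie.
Hypothesis Hsub : forall g g' : X, Rle (norm (br g g')) (Rmult (norm g) (norm g')).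

Lemma norm_ge0 (x : X) : 0 <= norm x.
Proof. exact/RleP/norm_nonneg. Qed.

Lemma norm0 : norm (0 : X) = 0.
Proof. by rewrite -(scale0r (0 : X)) [norm _]norm_scal RabsE normr0 RmultE mul0r. Qed.

Lemma normZ (r : R) (x : X) : norm (r *: x) = `|r| * norm x.
Proof. by rewrite [norm _]norm_scal RabsE. Qed.

Lemma norm_sum (I : Type) (r : seq I) (f : I -> X) :
  norm (\sum_(i <- r) f i) <= \sum_(i <- r) norm (f i).
Proof.
elim: r => [|i r IH]; first by rewrite !big_nil norm0.
rewrite !big_cons; apply: le_trans (lerD (lexx _) IH).
exact/RleP/norm_triangle.
Qed.

Lemma norm_br (x y : X) : norm (br x y) <= norm x * norm y.
Proof. exact/RleP/Hsub. Qed.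

Lemma conv_le (N : nat) (f : nat -> nat -> R) : (forall i j, 0 <= f i j) ->
  \sum_(i < N) \sum_(i1 < i.+1) f i1 (i - i1)%N <= \sum_(i < N) \sum_(j < N) f i j.
Proof.
move=> f0; rewrite -antidiagonal_sum; apply: ler_sum => i _.
rewrite (big_ord_widen N (fun j => f i j)) ?leq_subr// big_mkcond.
by apply: ler_sum => j _; case: ifP.
Qed.

Variables (c : nat -> R) (z : nat -> nat -> X) (y : X) (N : nat) (t : R).
Hypothesis Hz : cbhd_rec c z y.
Hypothesis t0 : 0 <= t.

Definition normsum : R := \sum_(i < N) \sum_(j < N) norm (z i j) * t ^+ j.

Lemma normsum_ge0 : 0 <= normsum.
Proof.
by apply: sumr_ge0 => i _; apply: sumr_ge0 => j _; rewrite mulr_ge0 ?norm_ge0 ?exprn_ge0.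
Qed.

(** Each application of [ad Z] costs one factor [normsum]: a truncated Cauchy product of nonnegative
    terms is at most the product of the truncated sums. *)
Lemma norm_adpow_sum k :
  \sum_(i < N) \sum_(j < N) norm (adpow z y k i j) * t ^+ j <= normsum ^+ k * (norm y * t).
Proof.
elim: k => [|k IH].
  have yt : 0 <= norm y * t by rewrite mulr_ge0 ?norm_ge0.
  rewrite expr0 mul1r; case: N => [|N']; first by rewrite big_ord0.
  rewrite big_ord_recl [X in _ + X]big1 ?addr0; last first.
    by move=> i _; rewrite big1// => j _; rewrite /= norm0 mul0r.
  case: N' => [|N'']; first by rewrite big_ord1 /= norm0 mul0r.
  rewrite !big_ord_recl big1 ?addr0 => [|j _]; last by rewrite /= norm0 mul0r.
  by rewrite /= norm0 mul0r add0r expr1.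
pose f i1 j1 i2 j2 := (norm (z i1 j1) * t ^+ j1) * (norm (adpow z y k i2 j2) * t ^+ j2).
have f0 i1 j1 i2 j2 : 0 <= f i1 j1 i2 j2.
  by rewrite /f !mulr_ge0 ?norm_ge0 ?exprn_ge0.
have le1 : \sum_(i < N) \sum_(j < N) norm (adpow z y k.+1 i j) * t ^+ j <=
   \sum_(i < N) \sum_(i1 < i.+1) \sum_(j < N) \sum_(j1 < j.+1) f i1 j1 (i - i1)%N (j - j1)%N.
  apply: ler_sum => i _; rewrite [leRHS]exchange_big /=; apply: ler_sum => j _.
  have tj : 0 <= t ^+ j by rewrite exprn_ge0.
  apply: le_trans (ler_wpM2r tj (norm_sum _ _)) _.
  rewrite mulr_suml; apply: ler_sum => i1 _.
  apply: le_trans (ler_wpM2r tj (norm_sum _ _)) _.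
  rewrite mulr_suml; apply: ler_sum => j1 _.
  have -> : t ^+ j = t ^+ j1 * t ^+ (j - j1) by rewrite -exprD subnKC// -ltnS.
  rewrite /f mulrACA; apply: ler_wpM2r; first by rewrite mulr_ge0 ?exprn_ge0.
  exact: norm_br.
apply: le_trans le1 _.
apply: le_trans (conv_le (f := fun i1 i2 => \sum_(j < N) \sum_(j1 < j.+1) f i1 j1 i2 (j - j1)%N) N _) _.
  by move=> i1 i2; apply: sumr_ge0 => j _; apply: sumr_ge0.
apply: (@le_trans _ _ (\sum_(i1 < N) \sum_(i2 < N) \sum_(j1 < N) \sum_(j2 < N) f i1 j1 i2 j2)).
  apply: ler_sum => i1 _; apply: ler_sum => i2 _.
  exact: (@conv_le N (fun j1 j2 => f i1 j1 i2 j2)).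
rewrite exprS -mulrA; apply: le_trans (ler_wpM2l normsum_ge0 IH).
rewrite /normsum mulr_suml; apply: ler_sum => i1 _.
rewrite exchange_big mulr_suml; apply: ler_sum => j1 _.
rewrite mulr_sumr; apply: ler_sum => i2 _.
by rewrite mulr_sumr.
Qed.

(** The left side is [t S' t] for [S t = normsum]; the factor [j] is what the recursion provides. *)
Lemma normsum_deriv_le :
  \sum_(i < N) \sum_(j < N) j%:R * norm (z i j) * t ^+ j <=
  norm y * t * \sum_(k < N + N) `|c k| * normsum ^+ k.
Proof.
apply: (@le_trans _ _ (\sum_(i < N) \sum_(j < N) \sum_(k < N + N)
   `|c k| * (norm (adpow z y k i j) * t ^+ j))).
  apply: ler_sum => i _; apply: ler_sum => j _.
  have tj : 0 <= t ^+ j by rewrite exprn_ge0.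
  have -> : j%:R * norm (z i j) = norm (j%:R *: z i j) by rewrite normZ normr_nat.
  rewrite Hz.2; apply: le_trans (ler_wpM2r tj (norm_sum _ _)) _.
  rewrite mulr_suml.
  (* [N + N] bounds the length of the recursion uniformly in [i, j < N]. *)
  have ij : ((i + j).+1 <= N + N)%N by have := ltn_ord i; have := ltn_ord j; lia.
  rewrite (big_ord_widen _ (fun k => norm (c k *: adpow z y k i j) * t ^+ j) ij) big_mkcond.
  apply: ler_sum => k _; case: ifP => _; first by rewrite normZ mulrA.
  by rewrite !mulr_ge0 ?norm_ge0.
under eq_bigr => i _ do rewrite exchange_big /=.
rewrite exchange_big /= mulr_sumr; apply: ler_sum => k _.
under eq_bigr => i _ do rewrite -mulr_sumr.
rewrite -mulr_sumr mulrCA; apply: ler_wpM2l => //; rewrite mulrC.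
exact: norm_adpow_sum.
Qed.
End NormBounds.

(** * Comparison with G *)

Lemma derivable_horner (p : {poly R}) (x : R) :
  derivable_pt_lim (fun x => p.[x]%R) x (p^`().[x]%R).
Proof.
elim/poly_ind: p => [|p c IH].
  have -> : (fun x : R => (0 : {poly R}).[x]%R) = fct_cte 0%R.
    by apply/funext => y; rewrite horner0.
  rewrite deriv0 horner0; exact: derivable_pt_lim_const.
have -> : (fun x : R => (p * 'X + c%:P)%R.[x]%R) =
    plus_fct (mult_fct (fun x => p.[x]%R) Ranalysis1.id) (fct_cte c).
  by apply/funext => y; rewrite !hornerE.
have -> : ((p * 'X + c%:P)^`().[x])%R = ((p^`().[x])%R * x + p.[x]%R * 1 + 0)%R.
  rewrite derivMXaddC !hornerE.
  by rewrite addrC.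
apply: derivable_pt_lim_plus; last exact: derivable_pt_lim_const.
apply: derivable_pt_lim_mult => //; exact: derivable_pt_lim_id.
Qed.

Section CotSeries.
Variable N : nat.

Definition cotpoly : {poly R} := (\sum_(k < N) cotc R k *: 'X^(k.*2))%R.
(* The term [k = 0], where the denominator vanishes, is harmless since [cotc 0 = 0]. *)
Definition cotprim : {poly R} := (\sum_(k < N) (cotc R k / (k.*2)%:R) *: 'X^(k.*2))%R.

Lemma horner_evenpoly (f : nat -> R) x :
  ((\sum_(k < N) f k *: 'X^(k.*2)).[x] = \sum_(k < N) f k * x ^+ k.*2)%R.
Proof. by rewrite horner_sum; apply: eq_bigr => k _; rewrite hornerZ hornerXn. Qed.

Lemma horner_deriv_evenpoly (f : nat -> R) x :
  (x * (\sum_(k < N) f k *: 'X^(k.*2))^`().[x] = \sum_(k < N) f k * (k.*2)%:R * x ^+ k.*2)%R.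
Proof.
rewrite raddf_sum horner_sum mulr_sumr; apply: eq_bigr => k _ /=.
rewrite derivZ derivXn hornerZ hornerMn hornerXn mulrCA -mulrA; congr (_ * _)%R.
by rewrite mulrnAr mulr_natl; case: (nat_of_ord k) => [|m] //; rewrite doubleS -exprS.
Qed.

Lemma cotprim_deriv x : (x * cotprim^`().[x] = cotpoly.[x])%R.
Proof.
rewrite (horner_deriv_evenpoly (fun k => cotc R k / (k.*2)%:R)%R) horner_evenpoly.
apply: eq_bigr => k _; case: (nat_of_ord k) => [|m]; first by rewrite cotc0 !mul0r.
by rewrite divfK// pnatr_eq0.
Qed.

(** Truncation turns the Riccati equation into an inequality: the square of the partial sum contains
    further nonnegative products. *)
Lemma cotpoly_riccati x : (0 <= x ->
  x * cotpoly^`().[x] + cotpoly.[x] <= x ^+ 2 + cotpoly.[x] ^+ 2)%R.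
Proof.
move=> x0; rewrite (horner_deriv_evenpoly (cotc R)) horner_evenpoly -big_split /=.
have -> : (\sum_(k < N) (cotc R k * (k.*2)%:R * x ^+ k.*2 + cotc R k * x ^+ k.*2) =
  \sum_(k < N) (nat_of_ord k == 1%N)%:R * x ^+ k.*2 +
  \sum_(k < N) \sum_(i < k.+1) (cotc R i * x ^+ i.*2) * (cotc R (k - i) * x ^+ (k - i).*2))%R.
  rewrite -big_split; apply: eq_bigr => k _ /=.
  have -> : (cotc R k * (k.*2)%:R * x ^+ k.*2 + cotc R k * x ^+ k.*2 =
     ((k.*2.+1)%:R * cotc R k) * x ^+ k.*2)%R.
    by rewrite -mulrDl -natr1 [((_ + 1) * _)%R]mulrDl mul1r [(cotc R k * _)%R]mulrC.
  rewrite cotc_rec mulrDl; congr (_ + _)%R; rewrite mulr_suml; apply: eq_bigr => i _.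
  by rewrite mulrACA -exprD -doubleD subnKC// -ltnS.
apply: lerD.
  case: (ltnP 1 N) => h.
    rewrite (bigD1 (Ordinal h))//= mul1r big1 ?addr0// => k nk.
    by move: nk; rewrite -val_eqE /= => /negbTE->; rewrite mul0r.
  rewrite big1 ?exprn_ge0// => k _; have -> : (nat_of_ord k == 1%N) = false.
    by have := ltn_ord k; lia.
  by rewrite mul0r.
apply: le_trans (conv_le (f := fun i j => (cotc R i * x ^+ i.*2 * (cotc R j * x ^+ j.*2))%R) N _) _.
  by move=> i j; rewrite !mulr_ge0 ?cotc_ge0 ?exprn_ge0.
rewrite expr2 mulr_suml; apply: ler_sum => i _.
by rewrite mulr_sumr.
Qed.

(* With [P = cotpoly] and [F] the left-hand side, the Riccati inequality gives
   [u F' <= P F]; the integrating factor is [exp (- cotprim)]. *)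
Lemma cotpoly_sin_cos u : 0 <= u <= PI ->
  (cotpoly.[u]%R - 1) * sin u + u * cos u <= 0.
Proof.
move=> [u0 upi].
pose P x := cotpoly.[x]%R; pose P' x := cotpoly^`().[x]%R.
pose Q x := cotprim.[x]%R; pose Q' x := cotprim^`().[x]%R.
pose F x := (P x - 1) * sin x + x * cos x.
pose F' x := (P' x - 0) * sin x + (P x - 1) * cos x + (1 * cos x + x * - sin x).
have dF x : derivable_pt_lim F x (F' x).
  apply: (derivable_pt_lim_plus (mult_fct (minus_fct P (fct_cte 1)) sin) (mult_fct Ranalysis1.id cos)).
    apply: derivable_pt_lim_mult; last exact: derivable_pt_lim_sin.
    apply: derivable_pt_lim_minus; [exact: derivable_horner|exact: derivable_pt_lim_const].
  apply: derivable_pt_lim_mult; [exact: derivable_pt_lim_id|exact: derivable_pt_lim_cos].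
pose Phi x := F x * exp (- Q x).
pose Phi' x := F' x * exp (- Q x) + F x * (exp (- Q x) * - Q' x).
have dPhi x : derivable_pt_lim Phi x (Phi' x).
  apply: (derivable_pt_lim_mult F (comp exp (opp_fct Q))) => //.
  apply: (derivable_pt_lim_comp (opp_fct Q) exp); last exact: derivable_pt_lim_exp.
  apply: derivable_pt_lim_opp; exact: derivable_horner.
have [->|un0] := Req_dec_T u 0; first by rewrite sin_0; lra.
have u_gt0 : 0 < u by lra.
have [c [Ec [c0 cu]]] := MVT_cor2 Phi Phi' 0 u u_gt0 (fun x _ => dPhi x).
have Phi0 : Phi 0 = 0 by rewrite /Phi /F sin_0; lra.
have sc : 0 <= sin c by apply: sin_ge_0; lra.
have Pc : c * P' c + P c <= c * c + P c * P c.
  have c_ge0 : (0 <= c :> R)%O by apply/RleP; lra.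
  by have /RleP := cotpoly_riccati c_ge0; rewrite !expr2.
have Qc : c * Q' c = P c by exact: cotprim_deriv.
have ec := exp_pos (- Q c).
(* Multiply [Pc] by [sin c >= 0]; the terms in [c^2] cancel and the remainder is [P F]. *)
have cF : c * F' c <= P c * F c.
  rewrite /F' /F; nra.
have cPhi : c * Phi' c <= 0.
  have -> : c * Phi' c = (c * F' c - (c * Q' c) * F c) * exp (- Q c) by rewrite /Phi'; ring.
  rewrite Qc; nra.
have Phic : Phi' c <= 0 by nra.
have : Phi u <= 0 by nra.
rewrite /Phi => h; have eu := exp_pos (- Q u); change (F u <= 0); nra.
Qed.
End CotSeries.

(** For [k > 0], [|K_(2k)| u^(2k) = cotc k (u/2)^(2k)]; the only nonzero odd term is
    [|K_1| u = u / 2]. *)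
Lemma sum_bern_even (m : nat) (u : R) :
  (\sum_(k < m.+1.*2) `|bern R k| * u ^+ k = 1 + u / 2 + (cotpoly m.+1).[u / 2])%R.
Proof.
elim: m => [|m IH].
  rewrite horner_evenpoly big_ord1 cotc0 mul0r addr0 !big_ord_recl big_ord0 addr0.
  by rewrite /= normr1 expr0 mulr1 normrN ger0_norm ?invr_ge0 ?ler0n// expr1 mulrC.
rewrite doubleS 2!big_ord_recr IH !horner_evenpoly [in RHS]big_ord_recr /=.
rewrite -!addrA; congr (_ + (_ + (_ + _)))%R.
rewrite !doubleK /= !doubleS /= odd_double /= normr0 mul0r addr0.
rewrite normrN normrM [(`|cotc _ _|)%R]ger0_norm ?cotc_ge0// normrX normrN.
rewrite [(`|4^-1|)%R]ger0_norm ?invr_ge0 ?ler0n// mulrAC mulrC; congr (_ * _)%R.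
rewrite -!doubleS -!mul2n !exprM -exprMn; congr (_ ^+ _)%R.
rewrite exprMn exprVn mulrC; congr (_ * _^-1)%R.
by rewrite -natrX.
Qed.

(** With [v = u / 2], [G u = 1 + v + (1 - v cot v)], and [cotpoly_sin_cos] divided by [sin v] bounds
    the partial sums of the last term. *)
Lemma G_ge_bern (m : nat) (u : R) : 0 <= u < 2 * PI ->
  Rle (\sum_(k < m) `|bern R k| * u ^+ k)%R (G u).
Proof.
move=> [u0 upi].
apply: (@Rle_trans _ (\sum_(k < m.+1.*2) `|bern R k| * u ^+ k)%R).
  apply/RleP; rewrite (big_ord_widen m.+1.*2 (fun k => `|bern R k| * u ^+ k)%R); last by lia.
  rewrite big_mkcond; apply: ler_sum => k _; case: ifP => // _.
  by rewrite mulr_ge0// exprn_ge0//; apply/RleP.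
rewrite sum_bern_even; set v := (u / 2)%R; have Ev : v = u / 2 by [].
have := @cotpoly_sin_cos m.+1 v; rewrite /G.
case: Req_dec_T => [uz|un0].
  move=> _; rewrite Ev uz; have -> : 0 / 2 = 0%R :> R by rewrite /Rdiv Rmult_0_l.
  rewrite horner_evenpoly big1; first by rewrite !addr0; apply: Rle_refl.
  move=> k _; case: (nat_of_ord k) => [|i]; first by rewrite cotc0 mul0r.
  by rewrite doubleS exprS mul0r mulr0.
rewrite -Ev => H; have sv : 0 < sin v by apply: sin_gt_0; lra.
move: H; move: (cotpoly m.+1).[v]%R => P H.
have {}H : (P - 1) * sin v + v * cos v <= 0 by apply: H; lra.
change (1 + v + P <= 2 + v * (1 - cot v)).
have -> : 2 + v * (1 - cot v) = (2 * sin v + v * sin v - v * cos v) / sin v.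
  by rewrite /cot; field; lra.
apply: (Rmult_le_reg_r (sin v)) => //.
by rewrite /Rdiv Rmult_assoc Rinv_l; lra.
Qed.

Lemma G_ge1 u : 0 <= u < 2 * PI -> 1 <= G u.
Proof.
move=> hu; have := @G_ge_bern 1 u hu.
by rewrite big_ord1 normr1 expr0 mulr1.
Qed.

(** * Convergence *)

Lemma Ginv_bounds u : 0 <= u < 2 * PI -> 0 < Ginv u <= 1.
Proof.
move=> /G_ge1 G1; split; first by apply: Rinv_0_lt_compat; lra.
rewrite -Rinv_1; apply: Rinv_le_contravar; lra.
Qed.

Lemma continuous_Ginv u : 0 < u < 2 * PI -> continuous Ginv u.
Proof.
move=> [u0 upi].
apply: (continuous_ext_loc _ (fun x => / (2 + x / 2 * (1 - cos (x / 2) / sin (x / 2))))).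
  exists (mkposreal u u0) => x /=; rewrite /ball /= /AbsRing_ball /= /abs /minus /plus /Hierarchy.opp /=.
  move=> /Rabs_def2 xu; rewrite /Ginv /G; case: Req_dec_T => //; lra.
have su : sin (u / 2) <> 0 by apply: Rgt_not_eq; apply: sin_gt_0; lra.
apply: ex_derive_continuous; auto_derive; split=> //; split=> //.
have h : 0 <= u < 2 * PI by lra.
by have := @G_ge1 u h; rewrite /G /cot; case: Req_dec_T => [|_]; rewrite /Rdiv; lra.
Qed.

(** * Comparison with the integral of [1 / G] *)

Section Comparison.
Variables (S S' : R -> R) (al be : R).
Hypothesis al0 : 0 <= al.
Hypothesis al_lt : al < 2 * PI.
Hypothesis be0 : 0 <= be.
Hypothesis dS : forall t, derivable_pt_lim S t (S' t).
Hypothesis S0 : S 0 = al.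
Hypothesis S_mono : forall s t, 0 <= s <= t -> S s <= S t.
Hypothesis S_gt0 : forall t, 0 < t <= 1 -> 0 < S t.
Hypothesis S_ode : forall t, 0 < t <= 1 -> S t < 2 * PI -> S' t <= be * G (S t).
Variable pr : Riemann_integrable Ginv al (2 * PI).
Hypothesis be_lt : be < RiemannInt pr.

Lemma ex_RInt_Ginv_sub u v : al <= u -> u <= v -> v <= 2 * PI -> ex_RInt Ginv u v.
Proof.
move=> au uv v2; have H := @ex_RInt_Reals_1 _ _ _ pr.
have H1 : ex_RInt Ginv u (2 * PI) by apply: ex_RInt_Chasles_2 H; lra.
by apply: ex_RInt_Chasles_1 H1; lra.
Qed.

Lemma RInt_Ginv_le u v : al <= u -> u <= v -> v <= 2 * PI -> RInt Ginv u v <= v - u.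
Proof.
move=> au uv v2.
have -> : v - u = RInt (fun=> 1) u v by rewrite RInt_const /Hierarchy.scal /= /mult /=; ring.
apply: RInt_le => //; [exact: ex_RInt_Ginv_sub|exact: ex_RInt_const|].
by move=> x hx; apply: (proj2 (@Ginv_bounds x _)); lra.
Qed.

(** Otherwise [S] reaches some [M < 2 PI] at a time [t1 <= 1]. Integrating [S' / G (S) <= be] up to
    [t1] would bound the integral of [1 / G] from [al] to [M] by about [be], against the choice of
    [M]. *)
Lemma comparison_le : S 1 <= 2 * PI.
Proof.
have I_def : RInt Ginv al (2 * PI) = RiemannInt pr by exact: RInt_Reals.
(* As [1 / G <= 1], cutting off the last [d / 2] of the interval costs at most [d / 2]: the integral
   up to [M] still exceeds [be], and [M > al]. *)
pose d := Rmin (RiemannInt pr - be) (2 * PI - al).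
have [d1 d2] : d <= RiemannInt pr - be /\ d <= 2 * PI - al.
  by split; [exact: Rmin_l|exact: Rmin_r].
have d0 : 0 < d by apply: Rmin_glb_lt; lra.
pose M := 2 * PI - d / 2.
have split1 u : al <= u -> u <= 2 * PI ->
    RInt Ginv al (2 * PI) = RInt Ginv al u + RInt Ginv u (2 * PI).
  by move=> h1 h2; rewrite -[LHS](RInt_Chasles Ginv al u (2 * PI)) //; apply: ex_RInt_Ginv_sub; lra.
have IM : be < RInt Ginv al M.
  have := split1 M; rewrite I_def.
  have := @RInt_Ginv_le M (2 * PI); rewrite /M => h1 h2; move: h1 h2; lra.
case: (Rle_lt_dec (S 1) (2 * PI)) => // S1.
have cS : continuity (fun t => S t - M).
  move=> t; apply: continuity_pt_minus; last exact: continuity_pt_const.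
  by apply: derivable_continuous_pt; exists (S' t); exact: dS.
have [t1 [[t10 t11] St1]] : {t1 | 0 <= t1 <= 1 /\ S t1 - M = 0}.
  by apply: IVT => //; rewrite ?S0 /M; lra.
have {}St1 : S t1 = M by lra.
have t1_gt0 : 0 < t1.
  case: (Req_dec_T t1 0) => h; last lra.
  by move: St1; rewrite h S0 /M; lra.
(* Starting at [eps] keeps [S] positive, where [Ginv] is continuous, even if [al = 0]; the part of
   the integral lost is below the available gap. *)
have [eps [eps0 [eps_lt Seps]]] : exists eps, 0 < eps /\ eps < t1 /\
    S eps - al < RInt Ginv al M - be.
  have eta0 : 0 < RInt Ginv al M - be by lra.
  have c0 : continuity_pt S 0 by apply: derivable_continuous_pt; exists (S' 0); exact: dS.
  have [dl [dl0 Hdl]] := c0 _ eta0.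
  exists (Rmin (dl / 2) (t1 / 2)).
  have m0 : 0 < Rmin (dl / 2) (t1 / 2) by apply: Rmin_glb_lt; lra.
  have := Rmin_l (dl / 2) (t1 / 2); have := Rmin_r (dl / 2) (t1 / 2) => h1 h2.
  split=> //; split; first lra.
  have := Hdl (Rmin (dl / 2) (t1 / 2)); rewrite /= /R_dist S0 => H.
  apply: Rle_lt_trans (Rle_abs _) (H _); split.
    by split=> //; lra.
  by rewrite Rminus_0_r Rabs_pos_eq; lra.
pose u0 := S eps.
have u0_gt0 : 0 < u0 by apply: S_gt0; lra.
have u0_al : al <= u0 by rewrite -S0; apply: S_mono; lra.
have S_bd t : eps <= t <= t1 -> u0 <= S t <= M.
  by move=> ht; split; [|rewrite -St1]; apply: S_mono; lra.
have u0_M := S_bd eps (conj (Rle_refl _) (Rlt_le _ _ eps_lt)).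
(* The differential inequality makes [H] nonincreasing on [[eps, t1]]. *)
pose H t := RInt Ginv u0 (S t) - be * t.
pose H' t := S' t * Ginv (S t) - be * 1.
have dH t : eps <= t <= t1 -> derivable_pt_lim H t (H' t).
  move=> ht; have hS := S_bd t ht.
  have S2 : 0 < S t < 2 * PI by rewrite /M in hS; lra.
  apply: derivable_pt_lim_minus; last first.
    by apply: derivable_pt_lim_scal; exact: derivable_pt_lim_id.
  apply/is_derive_Reals; apply: (is_derive_comp (fun u => RInt Ginv u0 u) S).
    apply: is_derive_RInt; last exact: continuous_Ginv.
    have r0 : 0 < Rmin (S t) (2 * PI - S t) by apply: Rmin_glb_lt; lra.
    exists (mkposreal _ r0) => x /=; rewrite /ball /= /AbsRing_ball /= /abs /minus /plus /Hierarchy.opp /=.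
    move=> /Rabs_def2; have := Rmin_l (S t) (2 * PI - S t); have := Rmin_r (S t) (2 * PI - S t).
    move=> h1 h2 h3; apply: RInt_correct; apply: ex_RInt_continuous => v hv.
    apply: continuous_Ginv; move: hv; rewrite /Rmin /Rmax; rewrite /M in u0_M.
    by case: Rle_dec => _; lra.
  by apply/is_derive_Reals; exact: dS.
have [c [Ec [c1 c2]]] := MVT_cor2 H H' eps t1 eps_lt dH.
have hc : eps <= c <= t1 by lra.
have hSc := S_bd c hc; rewrite /M in hSc.
have Sc2 : 0 <= S c < 2 * PI by lra.
have ode : S' c <= be * G (S c) by apply: S_ode; lra.
have G1 := G_ge1 Sc2.
have H'c : H' c <= 0.
  rewrite /H' /Ginv; have : S' c * / G (S c) <= be * G (S c) * / G (S c).
    by apply: Rmult_le_compat_r => //; apply: Rlt_le; apply: Rinv_0_lt_compat; lra.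
  by rewrite Rmult_assoc Rinv_r; lra.
have HH : H t1 - H eps <= 0.
  have t1e : 0 <= t1 - eps by lra.
  by rewrite Ec; nra.
rewrite /H St1 -/u0 RInt_point /Hierarchy.zero /= in HH.
have ch : RInt Ginv al M = RInt Ginv al u0 + RInt Ginv u0 M.
  rewrite -[LHS](RInt_Chasles Ginv al u0 M) //; apply: ex_RInt_Ginv_sub; rewrite /M in u0_M *; lra.
have := @RInt_Ginv_le al u0; rewrite /M in u0_M HH ch IM Seps *.
move=> /(_ (Rle_refl _) u0_al) h; have {}h : RInt Ginv al u0 <= u0 - al by apply: h; lra.
have : be * t1 <= be by nra.
have : 0 <= be * eps by nra.
rewrite -/u0 in Seps; lra.
Qed.
End Comparison.

Section Convergence.
Variable X : BanachLie.

Lemma sumXE (f : nat -> X) n : (sumX f n = \sum_(i < n.+1) f i)%R.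
Proof.
elim: n => [|n IH]; first by rewrite big_ord1.
by rewrite big_ord_recr /= -IH.
Qed.

Lemma homogE (z : nat -> nat -> X) n : (homog z n = \sum_(i < n.+1) z i (n - i)%N)%R.
Proof. exact: (sumXE (fun i => z i (n - i)%N)). Qed.

Lemma normN (x : X) : (norm (- x) = norm x)%R.
Proof. by rewrite -scaleN1r normZ normrN normr1 mul1r. Qed.

Lemma absolute_convergence (f : nat -> X) (B : R) :
  (forall n, (\sum_(k < n) norm (f k) <= B)%R) -> series_converges f.
Proof.
move=> HB; pose A n := (\sum_(k < n.+1) norm (f k))%R.
have A_grow : Un_growing A.
  move=> n; apply/RleP; rewrite /A [leRHS]big_ord_recr /=.
  by rewrite lerDl; apply: norm_ge0.
have A_ub : has_ub A.
  by exists B => x [n ->]; apply/RleP/HB.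
have [l Al] := growing_cv _ A_grow A_ub.
have A_cauchy : Cauchy_crit A by apply: CV_Cauchy; exists l.
have diff m n : (m <= n)%N -> (norm (sumX f n - sumX f m) <= A n - A m)%R.
  move=> mn; rewrite !sumXE /A -(subnKC mn).
  elim: (n - m)%N => [|d IH]; first by rewrite addn0 !subrr norm0.
  rewrite addnS big_ord_recr [X in (_ <= X - _)%R]big_ord_recr /= !(addrAC _ _ (- _)%R).
  apply: le_trans (lerD IH (lexx _)).
  exact/RleP/norm_triangle.
apply: (complete X) => eps eps0; have [N HN] := A_cauchy eps eps0.
exists N => m n mN nN; have := HN m n mN nN; apply: Rle_lt_trans.
apply/RleP; rewrite RdistE -[add _ _]/(sumX f m - sumX f n)%R.
have [mn|/ltnW nm] := leqP m n.
  by rewrite -normN opprB distrC; apply: le_trans (diff _ _ mn) (ler_norm _).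
by apply: le_trans (diff _ _ nm) (ler_norm _).
Qed.

Lemma homog_converges (z : nat -> nat -> X) (B : R) :
  (forall n, normsum z n 1 <= B) -> series_converges (homog z).
Proof.
move=> HB; apply: (@absolute_convergence _ B) => n.
have /RleP := HB n; apply: le_trans.
apply: (@le_trans _ _ (\sum_(k < n) \sum_(i < k.+1) norm (z i (k - i)%N))%R).
  by apply: ler_sum => k _; rewrite homogE; apply: norm_sum.
apply: le_trans (conv_le (f := fun i j => norm (z i j)) n _) _.
  by move=> i j; apply: norm_ge0.
rewrite /normsum; apply: ler_sum => i _; apply: ler_sum => j _.
by rewrite expr1n mulr1.
Qed.

Hypothesis Hsub : forall g g' : X, norm (br g g') <= norm g * norm g'.

Lemma normsum_bounded (c : nat -> R) (z : nat -> nat -> X) (x y : X) :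
  (forall k, `|c k| = `|bern R k|)%R ->
  (forall i, z i 0%N = if i == 1%N then x else 0%R) -> cbhd_rec c z y ->
  norm x < 2 * PI ->
  (exists pr : Riemann_integrable Ginv (norm x) (2 * PI), norm y < RiemannInt pr) ->
  forall n, normsum z n 1 <= 2 * PI.
Proof.
move=> Hc z0 Hz xpi [pr ypr] n0.
(* At least two indices are needed so that the term [z 1 0 = x] belongs to the sum and
   [S 0 = norm x]. *)
pose n := n0.+2.
apply: (@Rle_trans _ (normsum z n 1)).
  have nn : (n0 <= n)%N by rewrite /n; lia.
  apply/RleP; rewrite /normsum (big_ord_widen n (fun i => \sum_(j < n0) norm (z i j) * 1 ^+ j)%R nn).
  rewrite big_mkcond; apply: ler_sum => i _; case: ifP => _; last first.
    by apply: sumr_ge0 => j _; rewrite mulr_ge0 ?norm_ge0 ?exprn_ge0.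
  rewrite (big_ord_widen n (fun j => norm (z i j) * 1 ^+ j)%R nn) big_mkcond.
  apply: ler_sum => j _; case: ifP => // _.
  by rewrite mulr_ge0 ?norm_ge0 ?exprn_ge0.
pose s j := (\sum_(i < n) norm (z i j))%R.
pose p : {poly R} := (\sum_(j < n) s j *: 'X^j)%R.
have pE t : p.[t]%R = normsum z n t.
  rewrite /p /normsum exchange_big horner_sum; apply: eq_bigr => j _.
  by rewrite hornerZ hornerXn /s mulr_suml.
have p'E t : (t * p^`().[t] = \sum_(i < n) \sum_(j < n) j%:R * norm (z i j) * t ^+ j)%R.
  rewrite /p raddf_sum horner_sum mulr_sumr exchange_big; apply: eq_bigr => j _ /=.
  rewrite derivZ derivXn hornerZ hornerMn hornerXn /s mulrCA mulr_suml.
  apply: eq_bigr => i _; rewrite mulrnAr -[(_ *+ j)%R]mulr_natl mulrCA -mulrA.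
  by case: (nat_of_ord j) => [|m]; rewrite ?mul0r//= exprS.
have norm_x : (norm x = normsum z n 0)%R.
  rewrite -pE /p horner_sum big_ord_recl big1 ?addr0; last first.
    by move=> j _; rewrite hornerZ hornerXn /= exprS mul0r mulr0.
  rewrite hornerZ hornerXn expr0 mulr1 /s /n !big_ord_recl big1 ?addr0.
    by rewrite /= !z0 /= norm0 add0r.
  by move=> i _; rewrite z0 /= norm0.
(* The comparison needs [S > 0] on [(0, 1]]; if [S 1] vanishes the bound is trivial. *)
have [S1|S1] := Rle_lt_dec (normsum z n 1) 0.
  by have := PI_RGT_0; lra.
rewrite -pE.
apply: (@comparison_le (fun t => p.[t]%R) (fun t => p^`().[t]%R) (norm x) (norm y)) ypr => //.
- exact: norm_nonneg.
- exact: norm_nonneg.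
- by move=> t; apply: derivable_horner.
- by rewrite pE norm_x.
- move=> u v [u0 uv]; rewrite !pE; apply/RleP; apply: ler_sum => i _; apply: ler_sum => j _.
  apply: ler_wpM2l; first exact: norm_ge0.
  by apply: lerXn2r; rewrite ?nnegrE; apply/RleP => //; apply: Rle_trans u0 uv.
(* For [t <= 1] and [j < n] one has [t^j >= t^n], so [S t >= t^n S 1 > 0]. *)
- move=> t [t0 t1]; apply: (@Rlt_le_trans _ (normsum z n 1 * t ^+ n)%R).
    by apply/RltP; rewrite mulr_gt0 ?exprn_gt0//; apply/RltP.
  rewrite pE; apply/RleP; rewrite /normsum mulr_suml; apply: ler_sum => i _.
  rewrite mulr_suml; apply: ler_sum => j _; rewrite expr1n mulr1.
  apply: ler_wpM2l; first exact: norm_ge0.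
  by apply: ler_wiXn2l; [exact/RleP/Rlt_le|exact/RleP|exact: ltnW].
move=> t [t0 t1] St.
have t_ge0 : (0 <= t)%R by exact/RleP/Rlt_le.
have := normsum_deriv_le Hsub n Hz t_ge0; rewrite -p'E => /RleP h.
have S_ge0 : 0 <= normsum z n t by apply/RleP/normsum_ge0.
have hG := @G_ge_bern (n + n) (normsum z n t) (conj S_ge0 _).
rewrite pE in St *; have {}hG := hG St.
move: h; under eq_bigr => k _ do rewrite Hc.
move: hG; move: (\sum_(k < n + n) _)%R => W hG h.
have y0 := norm_nonneg X y.
apply: (Rmult_le_reg_l t) => //.
apply: Rle_trans h _; change (norm y * t * W <= t * (norm y * G (normsum z n t))).
have : 0 <= norm y * t by nra.
nra.
Qed.
End Convergence.

Theorem mainTheorem11 (X : BanachLie)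
  (Hsub : forall g g' : X, norm (br g g') <= norm g * norm g') :
  (forall a b : X,
     norm a < 2 * PI ->
     (exists pr : Riemann_integrable Ginv (norm a) (2 * PI), norm b < RiemannInt pr) ->
     forall z : nat -> nat -> X,
       (forall i j, IsZval i j a b (z i j)) ->
       series_converges (homog z)) /\
  (forall a b : X,
     norm b < 2 * PI ->
     (exists pr : Riemann_integrable Ginv (norm b) (2 * PI), norm a < RiemannInt pr) ->
     forall z : nat -> nat -> X,
       (forall i j, IsZval i j a b (z i j)) ->
       series_converges (homog z)).
Proof.
have sb k : (`|sbern R k| = `|bern R k|)%R by rewrite /sbern normrM normrX normrN1 expr1n mul1r.
have sb0 : sbern R 0 = 1%R by rewrite /sbern expr0 mul1r.
split=> a b ha hb z /IsZval_cbhd_rec[recR recL]; apply: (@homog_converges _ _ (2 * PI)).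
  (* The recursion counting y gives the differential inequality; the one counting x gives the
     initial terms [Z_(i,0)]. *)
  apply: (normsum_bounded Hsub sb _ recR ha hb) => i.
  exact: (@cbhd_rec_pure _ _ _ _ i (erefl : bern R 0 = 1%R) recL).
(* At [t = 1] the weights disappear, so the indices may be swapped and the roles of the two
   recursions exchanged. *)
move=> n; have -> : normsum z n 1%R = normsum (fun i j => z j i) n 1%R.
  rewrite /normsum exchange_big; apply: eq_bigr => i _; apply: eq_bigr => j _.
  by rewrite !expr1n.
apply: (normsum_bounded Hsub _ _ recL ha hb) => // i.
exact: (@cbhd_rec_pure _ _ _ _ i sb0 recR).
Qed.
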